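(* For any positive species $\mathbf{p}$ and $\mathbf{q}$, there is a natural isomorphism of monoids $$\mathcal{T}(\mathbf{p}\star\mathbf{q})\cong\mathcal{T}(\mathbf{p})\times\mathcal{T}(\mathbf{q}).$$
   Context: **Species and monoids.** Fix a field $\Bbbk$. A species is a functor from the category of finite sets and bijections to the category of $\Bbbk$-vector spaces; morphisms are natural transformations. A species $\mathbf{p}$ is positive if $\mathbf{p}[\emptyset]=0$. $I=S\sqcup T$ means $I=S\cup T$, $S\cap T=\emptyset$. A monoid is a species $\mathbf{p}$ with linear maps $\mu_{S,T}:\mathbf{p}[S]\otimes\mathbf{p}[T]\to\mathbf{p}[I]$ for each $I=S\sqcup T$, natural with respect to bijections, and $\iota_\emptyset:\Bbbk\to\mathbf{p}[\emptyset]$, associative ($\mu_{R\sqcup S,T}(\mu_{R,S}\otimes\mathrm{id})=\mu_{R,S\sqcup T}(\mathrm{id}\otimes\mu_{S,T})$) and unital. Morphisms of monoids are morphisms of species commuting with products and units. **Set compositions.** A composition $F=(I_1,\dots,I_k)$ of a finite set $I$ ($F\vDash I$) is an ordered sequence of disjoint nonempty subsets (blocks) with union $I$; the empty set has exactly one composition (no blocks). If $F\vDash S$, $G\vDash T$, $I=S\sqcup T$, then $F\cdot G\vDash I$ denotes their concatenation. Compositions of $I$ are partially ordered by refinement: $F\le G$ if each block of $F$ is obtained by merging a number of adjacent blocks of $G$. Identifying $(I_1,\dots,I_k)$ with the flag $\emptyset\subset I_1\subset I_1\cup I_2\subset\cdots\subset I$, the order is inclusion of flags; this is a meet-semilattice,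 with meet $F\wedge G$ corresponding to intersection of flags; for $I\neq\emptyset$ the minimum is the one-block composition $(I)$. **Free monoids.** For a positive species $\mathbf{q}$ and $F=(I_1,\dots,I_k)\vDash I$, put $\mathbf{q}(F)=\mathbf{q}[I_1]\otimes\cdots\otimes\mathbf{q}[I_k]$ ($=\Bbbk$ for the empty composition) and $\mathcal{T}(\mathbf{q})[I]=\bigoplus_{F\vDash I}\mathbf{q}(F)$, with bijections acting in the evident way. It is a monoid (the free monoid on $\mathbf{q}$) with product the sum of the canonical isomorphisms $\mathbf{q}(F)\otimes\mathbf{q}(G)\cong\mathbf{q}(F\cdot G)$. **The operation $\star$.** For positive species $\mathbf{p},\mathbf{q}$, the positive species $\mathbf{p}\star\mathbf{q}$ is given on nonempty $I$ by $$(\mathbf{p}\star\mathbf{q})[I]=\bigoplus_{F,G\vDash I,\ F\wedge G=(I)}\mathbf{p}(F)\otimes\mathbf{q}(G),$$ with bijections acting in the evident way (and $(\mathbf{p}\star\mathbf{q})[\emptyset]=0$). **Hadamard product.** $(\mathbf{p}\times\mathbf{q})[I]=\mathbf{p}[I]\otimes\mathbf{q}[I]$. If $\mathbf{p},\mathbf{q}$ are monoids, so is $\mathbf{p}\times\mathbf{q}$, with product obtained by switching the middle two tensor factors in $(\mathbf{p}[S]\otimes\mathbf{q}[S])\otimes(\mathbf{p}[T]\otimes\mathbf{q}[T])$ and applying $\mu_{S,T}\otimes\mu_{S,T}$, and unit given by the tensor product of the units. *)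

(* Defs.v *)
From HB Require Import structures.
From mathcomp Require Import all_boot all_algebra.
From mathcomp Require Import boolp.

Set Implicit Arguments.
Unset Strict Implicit.
Unset Printing Implicit Defensive.

Import GRing.Theory.
Local Open Scope ring_scope.
Local Open Scope quotient_scope.

Section LinearPack.
Variables (k : fieldType) (V W Z : lmodType k).

Definition pack_linear (f : V -> W) (fP : linear f) : {linear V -> W} :=
  locked
    (HB.pack f (GRing.isLinear.Build k V W *:%R f fP) : {linear V -> W}).

Definition pack_bilinear (f : V -> W -> Z) (fP : bilinear_for *:%R *:%R f) :
    {bilinear V -> W -> Z} :=
  locked
    (HB.pack f (bilinear_isBilinear.Build k V W Z *:%R *:%R f fP) : {bilinear V -> W -> Z}).

Lemma pack_linearE f (fP : linear f) v : pack_linear fP v = f v.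
Proof. by rewrite /pack_linear -lock. Qed.

Lemma pack_bilinearE f (fP : bilinear_for *:%R *:%R f) v w :
  pack_bilinear fP v w = f v w.
Proof. by rewrite /pack_bilinear -lock. Qed.
End LinearPack.

(* An element of the tensor product is a class of formal sums of pure tensors,
   the list [:: (v_1, w_1); ...; (v_n, w_n)] standing for
   v_1 (x) w_1 + ... + v_n (x) w_n; no separate coefficients are needed since
   a (v (x) w) = (a v) (x) w. *)
Section Tensor.
Variables (k : fieldType) (V W : lmodType k).

Inductive tens_rel : seq (V * W) -> seq (V * W) -> Prop :=
| tens_refl s : tens_rel s s
| tens_sym s t : tens_rel s t -> tens_rel t s
| tens_trans s t u : tens_rel s t -> tens_rel t u -> tens_rel s u
| tens_cat s s' t t' :
    tens_rel s s' -> tens_rel t t' -> tens_rel (s ++ t) (s' ++ t')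
| tens_catC s t : tens_rel (s ++ t) (t ++ s)
| tens_addl v v' w : tens_rel [:: (v + v', w)] [:: (v, w); (v', w)]
| tens_addr v w w' : tens_rel [:: (v, w + w')] [:: (v, w); (v, w')]
| tens_scale a v w : tens_rel [:: (a *: v, w)] [:: (v, a *: w)]
| tens_zero w : tens_rel [:: (0, w)] [::].

Definition tens_relb : rel (seq (V * W)) := fun s t => `[< tens_rel s t >].

Lemma tens_relb_refl : reflexive tens_relb.
Proof. by move=> s; apply/asboolP; constructor. Qed.

Lemma tens_relb_sym : symmetric tens_relb.
Proof. by move=> s t; apply/asboolP/asboolP; exact: tens_sym. Qed.

Lemma tens_relb_trans : transitive tens_relb.
Proof.
by move=> t s u /asboolP st /asboolP tu; apply/asboolP; exact: tens_trans st tu.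
Qed.

Canonical tens_equiv :=
  EquivRel tens_relb tens_relb_refl tens_relb_sym tens_relb_trans.

Definition tensor := {eq_quot tens_equiv}.

HB.instance Definition _ := Choice.on tensor.
HB.instance Definition _ := EqQuotient.on tensor.

Definition tens_pi (s : seq (V * W)) : tensor := \pi_tensor s.

Lemma tens_piP s t : tens_rel s t -> tens_pi s = tens_pi t.
Proof. by move=> st; apply/eqquotP/asboolP. Qed.

Lemma tens_pi_rel s t : tens_pi s = tens_pi t -> tens_rel s t.
Proof. by move=> /eqquotP/asboolP. Qed.

Lemma tens_reprK x : tens_pi (repr x) = x.
Proof. exact: reprK. Qed.

Lemma tens_repr_pi s : tens_rel (repr (tens_pi s)) s.
Proof. by apply: tens_pi_rel; rewrite tens_reprK. Qed.

Definition tens_scale_seq (a : k) (s : seq (V * W)) :=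
  [seq (a *: vw.1, vw.2) | vw <- s].

Definition tens_add (x y : tensor) := tens_pi (repr x ++ repr y).
Definition tens_scalar (a : k) (x : tensor) :=
  tens_pi (tens_scale_seq a (repr x)).
Definition tens_opp (x : tensor) := tens_scalar (-1) x.

Lemma tens_scale_rel a s t :
  tens_rel s t -> tens_rel (tens_scale_seq a s) (tens_scale_seq a t).
Proof.
rewrite /tens_scale_seq; elim=> {s t} /=.
- by move=> s; constructor.
- by move=> s t _; exact: tens_sym.
- by move=> s t u _ st _; exact: tens_trans st.
- by move=> s s' t t' _ ss' _ tt'; rewrite !map_cat; exact: tens_cat.
- by move=> s t; rewrite !map_cat; exact: tens_catC.
- by move=> v v' w; rewrite scalerDr; exact: tens_addl.
- by move=> v w w'; exact: tens_addr.
- by move=> b v w; rewrite scalerA mulrC -scalerA; exact: tens_scale.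
- by move=> w; rewrite scaler0; exact: tens_zero.
Qed.

Lemma tens_addE s t : tens_add (tens_pi s) (tens_pi t) = tens_pi (s ++ t).
Proof. by apply: tens_piP; apply: tens_cat; exact: tens_repr_pi. Qed.

Lemma tens_scalarE a s :
  tens_scalar a (tens_pi s) = tens_pi (tens_scale_seq a s).
Proof. by apply: tens_piP; apply: tens_scale_rel; exact: tens_repr_pi. Qed.

Lemma tens_ind_pi (P : tensor -> Prop) : (forall s, P (tens_pi s)) -> forall x, P x.
Proof. by move=> Ps x; rewrite -[x]tens_reprK. Qed.

Lemma tens_addA : associative tens_add.
Proof.
elim/tens_ind_pi=> s; elim/tens_ind_pi=> t; elim/tens_ind_pi=> u.
by rewrite !tens_addE catA.
Qed.

Lemma tens_addC : commutative tens_add.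
Proof.
elim/tens_ind_pi=> s; elim/tens_ind_pi=> t.
by rewrite !tens_addE; apply: tens_piP; exact: tens_catC.
Qed.

Lemma tens_add0 : left_id (tens_pi [::]) tens_add.
Proof. by elim/tens_ind_pi=> s; rewrite tens_addE. Qed.

Lemma tens_scalarDl a b x :
  tens_scalar (a + b) x = tens_add (tens_scalar a x) (tens_scalar b x).
Proof.
elim/tens_ind_pi: x => s; rewrite !tens_scalarE.
elim: s => [|[v w] s IHs]; first by rewrite tens_addE.
have E c : tens_scale_seq c ((v, w) :: s) =
  [:: (c *: v, w)] ++ tens_scale_seq c s by [].
rewrite !{}E -3!tens_addE IHs -tens_addA [RHS]tens_addA.
have -> : tens_pi [:: ((a + b) *: v, w)] =
  tens_add (tens_pi [:: (a *: v, w)]) (tens_pi [:: (b *: v, w)]).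
  by rewrite scalerDl tens_addE; apply: tens_piP; exact: tens_addl.
rewrite -!tens_addA; congr tens_add; rewrite !tens_addA; congr tens_add.
exact: tens_addC.
Qed.

Lemma tens_scalar0 x : tens_scalar 0 x = tens_pi [::].
Proof.
elim/tens_ind_pi: x => s; rewrite !tens_scalarE.
elim: s => [//|[v w] s IHs].
rewrite -[tens_scale_seq _ _]/([:: (0 *: v, w)] ++ tens_scale_seq 0 s).
rewrite -tens_addE IHs scale0r (tens_piP (tens_zero w)).
exact: tens_add0.
Qed.

Lemma tens_scalar1 x : tens_scalar 1 x = x.
Proof.
elim/tens_ind_pi: x => s; rewrite tens_scalarE /tens_scale_seq.
by congr tens_pi; elim: s => //= -[v w] s ->; rewrite scale1r.
Qed.

Lemma tens_addN : left_inverse (tens_pi [::]) tens_opp tens_add.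
Proof.
move=> x; rewrite /tens_opp -[X in tens_add _ X]tens_scalar1 -tens_scalarDl.
by rewrite addNr tens_scalar0.
Qed.

HB.instance Definition _ :=
  GRing.isZmodule.Build tensor tens_addA tens_addC tens_add0 tens_addN.

Lemma tens_scalarA a b x :
  tens_scalar a (tens_scalar b x) = tens_scalar (a * b) x.
Proof.
elim/tens_ind_pi: x => s; rewrite !tens_scalarE /tens_scale_seq -map_comp.
by congr tens_pi; apply: eq_map => vw /=; rewrite scalerA.
Qed.

Lemma tens_scalarDr : right_distributive tens_scalar +%R.
Proof.
move=> a x y; rewrite -[LHS]/(tens_scalar a (tens_add x y)).
rewrite -[RHS]/(tens_add (tens_scalar a x) (tens_scalar a y)).
elim/tens_ind_pi: x => s; elim/tens_ind_pi: y => t.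
by rewrite !(tens_addE, tens_scalarE) /tens_scale_seq map_cat.
Qed.

Lemma tens_scalarDl' x : {morph tens_scalar^~ x : a b / a + b}.
Proof. by move=> a b; exact: tens_scalarDl. Qed.

HB.instance Definition _ := GRing.Zmodule_isLmodule.Build k tensor
  tens_scalarA tens_scalar1 tens_scalarDr tens_scalarDl'.

Lemma tens_piD s t : tens_pi s + tens_pi t = tens_pi (s ++ t).
Proof. exact: tens_addE. Qed.

Lemma tens_piZ a s : a *: tens_pi s = tens_pi (tens_scale_seq a s).
Proof. exact: tens_scalarE. Qed.

Definition tens (v : V) (w : W) : tensor := tens_pi [:: (v, w)].

Lemma tens_is_bilinear : bilinear_for *:%R *:%R tens.
Proof.
split=> [w a v v'|v a w w'] /=.
  by rewrite /tens tens_piZ tens_piD; apply: tens_piP; exact: tens_addl.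
rewrite /tens tens_piZ tens_piD; apply: tens_piP.
apply: tens_trans (tens_addr _ _ _) _.
apply: (@tens_cat [:: _] [:: _] [:: _] [:: _]); last exact: tens_refl.
exact: tens_sym (tens_scale _ _ _).
Qed.

HB.instance Definition _ :=
  bilinear_isBilinear.Build k V W tensor *:%R *:%R tens tens_is_bilinear.

Lemma tens_piE s : tens_pi s = \sum_(vw <- s) tens vw.1 vw.2.
Proof.
elim: s => [|[v w] s IHs]; first by rewrite big_nil.
by rewrite big_cons -IHs tens_piD.
Qed.

Lemma tens_ind (P : tensor -> Prop) :
  P 0 -> (forall v w x, P x -> P (tens v w + x)) -> forall x, P x.
Proof.
move=> P0 PD; elim/tens_ind_pi; elim=> [|[v w] s /(PD v w)]; first exact: P0.
by rewrite tens_piD.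
Qed.

Section Lift.
Variables (Z : lmodType k) (b : {bilinear V -> W -> Z}).

Definition tens_lift_fun (x : tensor) : Z := \sum_(vw <- repr x) b vw.1 vw.2.

Lemma tens_lift_rel s t : tens_rel s t ->
  \sum_(vw <- s) b vw.1 vw.2 = \sum_(vw <- t) b vw.1 vw.2.
Proof.
elim=> //= {s t}.
- by move=> s t u _ -> _ ->.
- by move=> s s' t t' _ ss' _ tt'; rewrite !big_cat /= ss' tt'.
- by move=> s t; rewrite !big_cat /= addrC.
- by move=> v v' w; rewrite !(big_cons, big_nil) /= linearDl !addr0.
- by move=> v w w'; rewrite !(big_cons, big_nil) /= linearDr !addr0.
- by move=> a v w; rewrite !(big_cons, big_nil) /= linearZl_LR linearZr_LR.
- by move=> w; rewrite !(big_cons, big_nil) /= linear0l addr0.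
Qed.

Lemma tens_lift_pi s : tens_lift_fun (tens_pi s) = \sum_(vw <- s) b vw.1 vw.2.
Proof. exact: tens_lift_rel (tens_repr_pi s). Qed.

Lemma tens_lift_is_linear : linear tens_lift_fun.
Proof.
move=> a; elim/tens_ind_pi=> s; elim/tens_ind_pi=> t.
rewrite tens_piZ tens_piD !tens_lift_pi big_cat /=.
congr (_ + _); rewrite /tens_scale_seq big_map scaler_sumr.
by apply: eq_bigr => vw _; rewrite linearZl_LR.
Qed.

Definition tens_lift : {linear tensor -> Z} := pack_linear tens_lift_is_linear.

Lemma tens_liftE v w : tens_lift (tens v w) = b v w.
Proof. by rewrite /tens_lift pack_linearE tens_lift_pi big_cons big_nil addr0. Qed.
End Lift.

Lemma tens_ext (Z : lmodType k) (f g : {linear tensor -> Z}) :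
  (forall v w, f (tens v w) = g (tens v w)) -> f =1 g.
Proof.
move=> fg; elim/tens_ind=> [|v w x IHx]; first by rewrite !linear0.
by rewrite !linearD fg IHx.
Qed.

End Tensor.

Arguments tens : simpl never.

Notation "V \ox W" := (tensor V W) (at level 40, left associativity) : type_scope.
Notation "v *t w" := (tens v w) (at level 40, left associativity) : ring_scope.

Section TensorMap.
Variables (k : fieldType) (V V' W W' : lmodType k).
Variables (f : {linear V -> V'}) (g : {linear W -> W'}).

Lemma tens_map_is_bilinear :
  bilinear_for *:%R *:%R (fun v w => f v *t g w).
Proof.
split=> [w a v v'|v a w w'] /=; first by rewrite linearP linearPl.
by rewrite linearP linearPr.
Qed.

Definition tens_map : {linear V \ox W -> V' \ox W'} :=
  tens_lift (pack_bilinear tens_map_is_bilinear).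

Lemma tens_mapE v w : tens_map (v *t w) = f v *t g w.
Proof. by rewrite tens_liftE pack_bilinearE. Qed.
End TensorMap.

(* The switch of the middle two factors. *)
Section TensorSwitch.
Variables (k : fieldType) (V W V' W' : lmodType k).

Lemma tens_switch_right_bilinear (v : V) (w : W) :
  bilinear_for *:%R *:%R (fun (v' : V') (w' : W') => (v *t v') *t (w *t w')).
Proof. by split=> [w' a u u'|v' a u u'] /=; rewrite linearPr (linearPl, linearPr). Qed.

Definition tens_switch_right v w :=
  tens_lift (pack_bilinear (tens_switch_right_bilinear v w)).

Lemma tens_switch_rightE v w v' w' :
  tens_switch_right v w (v' *t w') = (v *t v') *t (w *t w').
Proof. by rewrite tens_liftE pack_bilinearE. Qed.

Lemma tens_switch_left_bilinear (z : V' \ox W') :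
  bilinear_for *:%R *:%R (fun v w => tens_switch_right v w z).
Proof.
split=> [w a v v'|v a w w'] /=; elim/tens_ind: z => [|x y z IHz].
- by rewrite !linear0 addr0.
- rewrite !(linearD (tens_switch_right _ _)) IHz scalerDr !tens_switch_rightE !linearPl.
  by rewrite addrACA.
- by rewrite !linear0 addr0.
- rewrite !(linearD (tens_switch_right _ _)) IHz scalerDr !tens_switch_rightE linearPl linearPr.
  by rewrite addrACA.
Qed.

Definition tens_switch_left z :=
  tens_lift (pack_bilinear (tens_switch_left_bilinear z)).

Lemma tens_switch_leftE z v w :
  tens_switch_left z (v *t w) = tens_switch_right v w z.
Proof. by rewrite tens_liftE pack_bilinearE. Qed.

Lemma tens_switch_bilinear :
  bilinear_for *:%R *:%R (fun (x : V \ox W) (z : V' \ox W') => tens_switch_left z x).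
Proof.
split=> [z a x y|x a z z'] /=; first by rewrite linearP.
elim/tens_ind: x => [|v w x IHx]; first by rewrite !linear0 addr0.
by rewrite !(linearD (tens_switch_left _)) IHx scalerDr !tens_switch_leftE linearP addrACA.
Qed.

Definition tens_switch : {linear (V \ox W) \ox (V' \ox W') -> (V \ox V') \ox (W \ox W')} :=
  tens_lift (pack_bilinear tens_switch_bilinear).

Lemma tens_switchE v w v' w' :
  tens_switch ((v *t w) *t (v' *t w')) = (v *t v') *t (w *t w').
Proof.
by rewrite tens_liftE pack_bilinearE tens_switch_leftE tens_switch_rightE.
Qed.
End TensorSwitch.

(* The index sets are finite, so the direct sum is the product. *)
Section DirectSum.
Variables (k : fieldType) (T : finType) (V : T -> lmodType k).

Definition dsum := {dffun forall i : T, V i}.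

HB.instance Definition _ := Choice.on dsum.

Definition dsum_add (x y : dsum) : dsum := [ffun i => x i + y i].
Definition dsum_opp (x : dsum) : dsum := [ffun i => - x i].
Definition dsum_zero : dsum := [ffun i => 0].
Definition dsum_scale (a : k) (x : dsum) : dsum := [ffun i => a *: x i].

Lemma dsum_addA : associative dsum_add.
Proof. by move=> x y z; apply/ffunP=> i; rewrite !ffunE addrA. Qed.
Lemma dsum_addC : commutative dsum_add.
Proof. by move=> x y; apply/ffunP=> i; rewrite !ffunE addrC. Qed.
Lemma dsum_add0 : left_id dsum_zero dsum_add.
Proof. by move=> x; apply/ffunP=> i; rewrite !ffunE add0r. Qed.
Lemma dsum_addN : left_inverse dsum_zero dsum_opp dsum_add.
Proof. by move=> x; apply/ffunP=> i; rewrite !ffunE addNr. Qed.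

HB.instance Definition _ :=
  GRing.isZmodule.Build dsum dsum_addA dsum_addC dsum_add0 dsum_addN.

Lemma dsum_scaleA a b x : dsum_scale a (dsum_scale b x) = dsum_scale (a * b) x.
Proof. by apply/ffunP=> i; rewrite !ffunE scalerA. Qed.
Lemma dsum_scale1 : left_id 1 dsum_scale.
Proof. by move=> x; apply/ffunP=> i; rewrite !ffunE scale1r. Qed.
Lemma dsum_scaleDr : right_distributive dsum_scale +%R.
Proof. by move=> a x y; apply/ffunP=> i; rewrite !ffunE scalerDr. Qed.
Lemma dsum_scaleDl x : {morph dsum_scale^~ x : a b / a + b}.
Proof. by move=> a b; apply/ffunP=> i; rewrite !ffunE scalerDl. Qed.

HB.instance Definition _ := GRing.Zmodule_isLmodule.Build k dsum
  dsum_scaleA dsum_scale1 dsum_scaleDr dsum_scaleDl.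

Lemma dsumDE (x y : dsum) i : (x + y) i = x i + y i.
Proof. exact: ffunE. Qed.
Lemma dsumZE a (x : dsum) i : (a *: x) i = a *: x i.
Proof. exact: ffunE. Qed.
Lemma dsum0E i : (0 : dsum) i = 0.
Proof. exact: ffunE. Qed.

Definition dsum_in_fun (i : T) (v : V i) : dsum :=
  [ffun j => if i =P j is ReflectT ij then ecast j (V j) ij v else 0].

Lemma dsum_in_fun_id i v : @dsum_in_fun i v i = v.
Proof. by rewrite ffunE; case: eqP => // e; rewrite eq_axiomK. Qed.

Lemma dsum_in_fun_neq i j v : i != j -> @dsum_in_fun i v j = 0.
Proof. by move=> ij; rewrite ffunE; case: eqP => // e; rewrite e eqxx in ij. Qed.

Lemma dsum_in_is_linear i : linear (@dsum_in_fun i).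
Proof.
move=> a v w; apply/ffunP=> j; rewrite dsumDE dsumZE.
have [<-|ij] := eqVneq i j; first by rewrite !dsum_in_fun_id.
by rewrite !dsum_in_fun_neq // scaler0 addr0.
Qed.

Definition dsum_in i : {linear V i -> dsum} :=
  pack_linear (@dsum_in_is_linear i).

Lemma dsum_in_id i v : dsum_in i v i = v.
Proof. by rewrite pack_linearE dsum_in_fun_id. Qed.

Lemma dsum_in_neq i j v : i != j -> dsum_in i v j = 0.
Proof. by rewrite pack_linearE => /dsum_in_fun_neq. Qed.

Lemma dsum_in_tagged i j (v : V i) (w : V j) :
  Tagged (fun l => V l : Type) v = Tagged (fun l => V l : Type) w ->
  dsum_in i v = dsum_in j w.
Proof.
move=> vw.
exact: (congr1 (fun u : {l : T & V l : Type} => dsum_in (tag u) (tagged u)) vw).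
Qed.

Lemma dsum_sumE (x : dsum) : x = \sum_i dsum_in i (x i).
Proof.
apply/ffunP=> j.
have -> : (\sum_i dsum_in i (x i)) j = \sum_i (dsum_in i (x i)) j.
  by elim/big_rec2: _ => [|i y1 y2 _ <-]; rewrite ?dsum0E ?dsumDE.
rewrite (bigD1 j) //= big1 ?addr0 ?dsum_in_id // => i ij.
exact: dsum_in_neq.
Qed.

Section Lift.
Variables (Z : lmodType k) (f : forall i, {linear V i -> Z}).

Definition dsum_lift_fun (x : dsum) : Z := \sum_i f i (x i).

Lemma dsum_lift_is_linear : linear dsum_lift_fun.
Proof.
move=> a x y; rewrite scaler_sumr -big_split /=; apply: eq_bigr => i _.
by rewrite dsumDE dsumZE linearP.
Qed.

Definition dsum_lift : {linear dsum -> Z} := pack_linear dsum_lift_is_linear.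

Lemma dsum_lift_in i v : dsum_lift (dsum_in i v) = f i v.
Proof.
rewrite pack_linearE /dsum_lift_fun (bigD1 i) //= dsum_in_id big1 ?addr0 //.
by move=> j ji; rewrite dsum_in_neq ?linear0 // eq_sym.
Qed.
End Lift.

Lemma dsum_ext (Z : lmodType k) (f g : {linear dsum -> Z}) :
  (forall i v, f (dsum_in i v) = g (dsum_in i v)) -> f =1 g.
Proof.
move=> fg x; rewrite [x]dsum_sumE !linear_sum.
by apply: eq_bigr => i _; exact: fg.
Qed.
End DirectSum.
Arguments dsum_in {k T} V i.

Definition fin0 : finType := void.

Record inj (S I : finType) := Inj {
  inj_fun :> S -> I;
  injP : injective inj_fun
}.

Record bij (I J : finType) := Bij {
  bij_fun :> I -> J;
  bijP : bijective bij_fun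
}.

Definition bij_id I : bij I I :=
  @Bij I I id (Bijective (fun=> erefl) (fun=> erefl)).
Definition comp_bij I J L (g : bij J L) (f : bij I J) : bij I L :=
  Bij (bij_comp (bijP g) (bijP f)).
Definition inj_of_bij I J (f : bij I J) : inj I J := Inj (bij_inj (bijP f)).

Lemma bij_ext I J (f g : bij I J) : f =1 g -> f = g.
Proof.
case: f g => [f fP] [g gP] /= /funext fg; case: _ / fg in gP *.
by congr Bij; exact: Prop_irrelevance.
Qed.

(* A finite set is a finite type, and a subset A of I is seen as a finite set
   in its own right through the subtype sub A. *)
Definition sub (I : finType) (A : {set I}) : finType := {x : I | x \in A}.

Section Restriction.
Variables (S I : finType) (f : inj S I) (A : {set S}).

Definition restr_fun (x : sub A) : sub (f @: A) :=
  exist _ (f (val x)) (imset_f f (valP x)).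

Lemma restr_bij : bijective restr_fun.
Proof.
apply: inj_card_bij; last by rewrite !card_sig card_imset //; exact: injP.
by move=> x y /(congr1 val) /injP /val_inj.
Qed.

Definition restr : bij (sub A) (sub (f @: A)) := Bij restr_bij.
End Restriction.

(* I = S \sqcup T: the finite sets S and T are identified with complementary
   subsets of I through the inclusions. *)
Record decomp (S T I : finType) := Decomp {
  incl : inj S I;
  incr : inj T I;
  decomp_cover : [set incl s | s : S] :|: [set incr t | t : T] = [set: I];
  decomp_disj : [disjoint [set incl s | s : S] & [set incr t | t : T]]
}.

Record species (k : fieldType) := Species {
  sp_obj :> finType -> lmodType k;
  sp_map : forall I J, bij I J -> {linear sp_obj I -> sp_obj J};
  sp_map_id : forall I x, sp_map (bij_id I) x = x;
  sp_map_comp : forall I J L (g : bij J L) (f : bij I J) x,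
    sp_map (comp_bij g f) x = sp_map g (sp_map f x)
}.

Definition positive k (p : species k) :=
  forall I : finType, #|I| = 0%N -> forall x : p I, x = 0.

Record pos_species (k : fieldType) := PosSpecies {
  pos_sp :> species k;
  pos_spP : positive pos_sp
}.

Record sp_hom k (p q : species k) := SpHom {
  sp_hom_fun :> forall I, {linear p I -> q I};
  sp_hom_nat : forall I J (f : bij I J) x,
    sp_hom_fun J (sp_map p f x) = sp_map q f (sp_hom_fun I x)
}.

(* The empty set is represented by the empty type; a product p[S] (x) p[T] -> p[I] is
   given for every I = S \sqcup T. *)
Record monoid (k : fieldType) := Monoid {
  mon_sp :> species k;
  mu : forall S T I, decomp S T I ->
    {linear mon_sp S \ox mon_sp T -> mon_sp I};
  mon_unit : {linear k^o -> mon_sp fin0};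
  mu_nat : forall S T I S' T' I' (d : decomp S T I) (d' : decomp S' T' I')
      (f : bij S S') (g : bij T T') (h : bij I I'),
    (forall s, h (incl d s) = incl d' (f s)) ->
    (forall t, h (incr d t) = incr d' (g t)) ->
    forall z, sp_map mon_sp h (mu d z) =
              mu d' (tens_map (sp_map mon_sp f) (sp_map mon_sp g) z);
  mu_assoc : forall R S T RS ST I (d1 : decomp R S RS) (d2 : decomp RS T I)
      (d3 : decomp S T ST) (d4 : decomp R ST I),
    (forall r, incl d2 (incl d1 r) = incl d4 r) ->
    (forall s, incl d2 (incr d1 s) = incr d4 (incl d3 s)) ->
    (forall t, incr d2 t = incr d4 (incr d3 t)) ->
    forall x y z, mu d2 (mu d1 (x *t y) *t z) = mu d4 (x *t mu d3 (y *t z));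
  mu_unitl : forall I (d : decomp fin0 I I), incr d =1 id ->
    forall x, mu d (mon_unit 1 *t x) = x;
  mu_unitr : forall I (d : decomp I fin0 I), incl d =1 id ->
    forall x, mu d (x *t mon_unit 1) = x
}.

Record mon_hom k (M N : monoid k) := MonHom {
  mon_hom_sp :> sp_hom M N;
  mon_hom_mu : forall S T I (d : decomp S T I) z,
    mon_hom_sp I (mu M d z) = mu N d (tens_map (mon_hom_sp S) (mon_hom_sp T) z);
  mon_hom_unit : forall c, mon_hom_sp fin0 (mon_unit M c) = mon_unit N c
}.

Definition mon_iso k (M N : monoid k) (f : mon_hom M N) :=
  exists g : mon_hom N M,
    (forall I x, g I (f I x) = x) /\ (forall I y, f I (g I y) = y).

Section Compositions.
Variable I : finType.

Definition is_comp (F : seq {set I}) : bool :=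
  [&& set0 \notin F, pairwise (fun A B : {set I} => [disjoint A & B]) F
    & \bigcup_(A <- F) A == [set: I]].

Record comp := Comp {
  comp_seq :> seq {set I};
  compP : is_comp comp_seq
}.

HB.instance Definition _ := [isSub for comp_seq].
HB.instance Definition _ := [Choice of comp by <:].

Lemma pairwise_disjoint_count (F : seq {set I}) :
  pairwise (fun A B : {set I} => [disjoint A & B]) F =
  [forall x, count (fun A : {set _} => x \in A) F <= 1]%N.
Proof.
elim: F => [|A F IHF] /=; first by apply/esym/forallP.
rewrite IHF; apply/andP/forallP => [[/allP AF /forallP F1] x|F1].
  case: (boolP (x \in A)) => [xA|_]; last exact: F1.
  rewrite -[1%N]addn0 leq_add2l leqn0 eqn0Ngt -has_count.
  apply/hasPn=> B /AF; rewrite disjoint_subset => /subsetP /(_ _ xA).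
  by rewrite inE.
split; last by apply/forallP=> x; exact: leq_trans (leq_addl _ _) (F1 x).
apply/allP=> B BF; rewrite disjoint_subset; apply/subsetP=> x xA; rewrite inE.
apply/negP=> xB; move: (F1 x); rewrite xA -ltnS ltnNge addnC addn1 ltnS.
by rewrite -has_count; case/hasP; exists B.
Qed.

Lemma in_bigcup_seq x (F : seq {set I}) :
  (x \in \bigcup_(A <- F) A) = has (fun A : {set _} => x \in A) F.
Proof.
by elim: F => [|A F IHF]; rewrite ?big_nil ?big_cons ?inE //= IHF.
Qed.

Lemma is_compE F :
  is_comp F = (set0 \notin F) && [forall x, count (fun A : {set _} => x \in A) F == 1%N].
Proof.
rewrite /is_comp pairwise_disjoint_count; congr (_ && _).
apply/andP/forallP => [[/forallP F1 /eqP FT] x|F1].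
  by rewrite eqn_leq F1 -has_count -in_bigcup_seq FT inE.
split; first by apply/forallP=> x; rewrite (eqP (F1 x)).
by apply/eqP/setP=> x; rewrite inE in_bigcup_seq has_count (eqP (F1 x)).
Qed.

Lemma comp_size (F : comp) : (size F <= #|I|)%N.
Proof.
have := compP F; rewrite is_compE => /andP[F0 /forallP F1].
have -> : #|I| = (\sum_(x : I) count (fun A : {set _} => x \in A) F)%N.
  by rewrite -sum1_card; apply: eq_bigr => x _; rewrite (eqP (F1 x)).
under eq_bigr do rewrite -sum1_count big_mkcond.
rewrite exchange_big /= -sum1_size !big_seq.
apply: leq_sum => A AF; rewrite -big_mkcond /= sum1_card card_gt0.
by apply: contraNneq F0 => <-.
Qed.

Definition comp_bseq (F : comp) : #|I|.-bseq {set I} := Bseq (comp_size F).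
Definition bseq_comp (F : #|I|.-bseq {set I}) : option comp := insub (val F).

Lemma comp_bseqK : pcancel comp_bseq bseq_comp.
Proof. by move=> F; rewrite /bseq_comp valK. Qed.

HB.instance Definition _ := Countable.copy comp (pcan_type comp_bseqK).
HB.instance Definition _ : isFinite comp := PCanIsFinite comp_bseqK.

(* F is identified with the flag of the unions of its initial segments. *)
Definition flag (F : seq {set I}) : {set {set I}} :=
  [set \bigcup_(A <- take i F) A | i : 'I_(size F).+1].

(* Refinement of compositions: F <= G. *)
Definition comp_le (F G : seq {set I}) : bool := flag F \subset flag G.

(* H is the meet of F and G. *)
Definition is_meet (F G H : seq {set I}) : bool :=
  flag H == flag F :&: flag G.

End Compositions.

Section CompositionMaps.

Definition seq_im (S I : finType) (f : S -> I) (F : seq {set S}) :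
  seq {set I} := [seq f @: A | A : {set S} <- F].

Lemma count_seq_im (S I : finType) (f : inj S I) F s :
  count (fun A : {set _} => f s \in A) (seq_im f F) = count (fun A : {set _} => s \in A) F.
Proof.
rewrite count_map; apply: eq_count => A /=; rewrite mem_imset //; exact: injP.
Qed.

Lemma count_seq_im0 (S I : finType) (f : inj S I) F x :
  x \notin [set f s | s : S] ->
  count (fun A : {set I} => x \in A) (seq_im f F) = 0%N.
Proof.
move=> xf; rewrite count_map; apply/eqP; rewrite -leqn0 leqNgt -has_count.
apply: contra xf => /hasP[A _ /imsetP[s _ ->]]; exact: imset_f.
Qed.

Lemma set0_seq_im (S I : finType) (f : S -> I) F :
  (set0 \in seq_im f F) = (set0 \in F).
Proof.
apply/mapP/idP => [[A AF /esym/eqP]|F0]; last by exists set0; rewrite ?imset0.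
by rewrite imset_eq0 => /eqP <-.
Qed.

Lemma is_comp_im (I J : finType) (f : bij I J) (F : comp I) :
  is_comp (seq_im f F).
Proof.
have := compP F; rewrite !is_compE set0_seq_im => /andP[-> /forallP F1] /=.
have [g fK gK] := bijP f.
by apply/forallP=> x; rewrite -[x]gK (count_seq_im (inj_of_bij f)).
Qed.

Definition comp_im (I J : finType) (f : bij I J) (F : comp I) : comp J :=
  Comp (is_comp_im f F).

Lemma is_comp_cat (S T I : finType) (d : decomp S T I)
    (F : comp S) (G : comp T) :
  is_comp (seq_im (incl d) F ++ seq_im (incr d) G).
Proof.
have := (compP F, compP G); rewrite !is_compE mem_cat !set0_seq_im.
case=> /andP[/negPf -> /forallP F1] /andP[/negPf -> /forallP G1] /=.
apply/forallP=> x; rewrite count_cat.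
have := in_setT x; rewrite -(decomp_cover d) inE => /orP[] xd.
  rewrite (count_seq_im0 _ (negbT (disjointFr (decomp_disj d) xd))) addn0.
  by case/imsetP: xd => s _ ->; rewrite count_seq_im.
rewrite (count_seq_im0 _ (negbT (disjointFl (decomp_disj d) xd))) add0n.
by case/imsetP: xd => s _ ->; rewrite count_seq_im.
Qed.

(* The concatenation F . G. *)
Definition comp_cat (S T I : finType) (d : decomp S T I)
    (F : comp S) (G : comp T) : comp I :=
  Comp (is_comp_cat d F G).

Lemma is_comp_nil : is_comp ([::] : seq {set fin0}).
Proof. by rewrite is_compE /=; apply/forallP; case. Qed.

Definition comp_nil : comp fin0 := Comp is_comp_nil.

Lemma flag_im (I J : finType) (f : I -> J) F :
  flag (seq_im f F) = [set f @: A | A : {set I} in flag F].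
Proof.
have E n : \bigcup_(B <- take n (seq_im f F)) B =
    f @: \bigcup_(A <- take n F) A.
  rewrite -map_take; elim: (take n F) => [|A s IHs] /=.
    by rewrite !big_nil imset0.
  by rewrite !big_cons IHs imsetU.
have sz : size (seq_im f F) = size F by rewrite size_map.
apply/setP=> B; apply/imsetP/imsetP => [[i _ ->]|[A /imsetP[i _ ->] ->]].
  exists (\bigcup_(A <- take i F) A); last exact: E.
  by apply/imsetP; exists (cast_ord (congr1 S sz) i).
by exists (cast_ord (congr1 S (esym sz)) i) => //; rewrite E.
Qed.

Lemma is_meet_im (I J : finType) (f : inj I J) F G H :
  is_meet F G H -> is_meet (seq_im f F) (seq_im f G) (seq_im f H).
Proof.
rewrite /is_meet !flag_im => /eqP ->; rewrite imsetI // => A B _ _.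
exact: imset_inj (@injP _ _ f) _ _.
Qed.

End CompositionMaps.

Section BlockTensor.
Variables (k : fieldType) (p : species k).

(* p(F) = p[I_1] (x) (p[I_2] (x) ( ... (p[I_k] (x) k))), the last factor being
   the ground field. *)
Fixpoint block_tens (I : finType) (F : seq {set I}) : lmodType k :=
  if F is A :: F' then p (sub A) \ox block_tens F' else k^o.

Fixpoint block_map (S I : finType) (f : inj S I) (F : seq {set S}) :
    {linear block_tens F -> block_tens (seq_im f F)} :=
  match F with
  | [::] => idfun
  | A :: F' => tens_map (sp_map p (restr f A)) (block_map f F')
  end.

Lemma scale_is_linear (V : lmodType k) (y : V) :
  linear (fun c : k^o => (c : k) *: y).
Proof. by move=> a c c'; rewrite scalerDl -scalerA. Qed.

Fixpoint block_catl (I : finType) (F G : seq {set I}) (y : block_tens G) :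
    {linear block_tens F -> block_tens (F ++ G)} :=
  match F with
  | [::] => pack_linear (scale_is_linear y)
  | A :: F' => tens_map idfun (block_catl F' y)
  end.

Lemma block_catl_bilinear (I : finType) (F G : seq {set I}) :
  bilinear_for *:%R *:%R (fun x y => @block_catl I F G y x).
Proof.
split=> [y a x x'|x a y y'] /=; first exact: linearP.
elim: F x => [|A F IHF] /= x.
  by rewrite !pack_linearE scalerDr !scalerA mulrC.
elim/tens_ind: x => [|v w x IHx]; first by rewrite !linear0 addr0.
rewrite !(linearD (tens_map _ _)) IHx !tens_mapE IHF linearPr scalerDr.
by rewrite addrACA.
Qed.

(* The canonical isomorphism p(F) (x) p(G) -> p(F . G). *)
Definition block_cat (I : finType) (F G : seq {set I}) :
    {linear block_tens F \ox block_tens G -> block_tens (F ++ G)} :=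
  tens_lift (pack_bilinear (block_catl_bilinear F G)).

Arguments block_cat {I F G}.

Lemma block_catE I (F G : seq {set I}) (x : block_tens F) (y : block_tens G) :
  block_cat (x *t y) = block_catl F y x.
Proof. by rewrite tens_liftE pack_bilinearE. Qed.

(* Pure tensors over the blocks of a composition. *)
Definition block_vec (I : finType) := {A : {set I} & p (sub A) : Type}.

Fixpoint pure (I : finType) (s : seq (block_vec I)) :
    block_tens [seq tag u | u <- s] :=
  match s with
  | [::] => 1
  | u :: s' => tagged u *t pure s'
  end.

Lemma block_ind I F (P : block_tens F -> Prop) :
    P 0 -> (forall a x y, P x -> P y -> P (a *: x + y)) ->
    (forall (s : seq (block_vec I)) (e : [seq tag u | u <- s] = F),
       P (ecast F (block_tens F) e (pure s))) ->
  forall x, P x.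
Proof.
elim: F P => [|A F IHF] /= P P0 PD Ppure x.
  rewrite -[x]addr0 -[x]mulr1; apply: (PD) => //.
  exact: (Ppure [::] erefl).
elim/tens_ind: x => [//|v w x Px]; rewrite -[v *t w]scale1r; apply: (PD) => //.
elim/IHF: w => [|a w w' Pw Pw'|s e]; first by rewrite linear0r.
  by rewrite linearPr; apply: (PD).
subst F; exact: (Ppure (Tagged (fun A => p (sub A) : Type) v :: s) erefl).
Qed.

Definition vec_map S I (f : inj S I) (u : block_vec S) : block_vec I :=
  Tagged (fun A : {set I} => p (sub A) : Type)
    (sp_map p (restr f (tag u)) (tagged u)).

Local Notation btag x := (Tagged (fun F => block_tens F : Type) x).

Lemma btag_cons I (A : {set I}) (v : p (sub A)) F G
    (x : block_tens F) (y : block_tens G) :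
  btag x = btag y ->
  Tagged (fun F => block_tens F : Type) (i := A :: F) (v *t x) =
  Tagged (fun F => block_tens F : Type) (i := A :: G) (v *t y).
Proof.
exact: (congr1 (fun u : {F : seq {set I} & block_tens F : Type} =>
  Tagged (fun F => block_tens F : Type) (i := A :: tag u) (v *t tagged u))).
Qed.

Lemma block_map_pure S I (f : inj S I) s :
  btag (block_map f _ (pure s)) = btag (pure (map (vec_map f) s)).
Proof. by elim: s => //= u s IHs; rewrite tens_mapE; exact: btag_cons. Qed.

Lemma block_cat_pure I (s t : seq (block_vec I)) :
  btag (block_cat (pure s *t pure t)) = btag (pure (s ++ t)).
Proof.
rewrite block_catE; elim: s => [|u s IHs] /=.
  by rewrite pack_linearE scale1r.
by rewrite tens_mapE; exact: btag_cons.
Qed.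

Lemma sp_map_tagged C I (A B : {set I}) (g : bij C (sub A)) (h : bij C (sub B)) :
    A = B -> (forall x, val (g x) = val (h x)) -> forall a,
  Tagged (fun A : {set I} => p (sub A) : Type) (sp_map p g a) =
  Tagged (fun A : {set I} => p (sub A) : Type) (sp_map p h a).
Proof.
move=> AB; case: _ / AB in h * => gh a.
by rewrite (@bij_ext _ _ g h) // => x; apply: val_inj.
Qed.

Lemma vec_map_id I (f : inj I I) : f =1 id -> vec_map f =1 id.
Proof.
move=> fid [A a]; rewrite /vec_map /= -[in RHS](sp_map_id a).
apply: sp_map_tagged => [|x]; last exact: fid.
by rewrite (eq_imset _ fid) imset_id.
Qed.

Lemma vec_map_comp S I J S' (f : inj S I) (g : inj I J) (f' : inj S S')
    (g' : inj S' J) :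
  (forall s, g (f s) = g' (f' s)) ->
  forall u, vec_map g (vec_map f u) = vec_map g' (vec_map f' u).
Proof.
move=> fg [A a]; rewrite /vec_map /= -!sp_map_comp.
apply: sp_map_tagged => [|x]; last exact: fg.
by rewrite -!imset_comp; apply: eq_imset.
Qed.

Lemma vec_map_comp1 S I J (f : inj S I) (g : inj I J) (h : inj S J) :
  (forall s, g (f s) = h s) ->
  forall u, vec_map g (vec_map f u) = vec_map h u.
Proof.
move=> fg [A a]; rewrite /vec_map /= -sp_map_comp.
apply: sp_map_tagged => [|x]; last exact: fg.
by rewrite -imset_comp; apply: eq_imset.
Qed.

Lemma tag_vec_map S I (f : inj S I) s :
  map tag (map (vec_map f) s) = seq_im f (map tag s).
Proof. by rewrite /seq_im -!map_comp. Qed.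

End BlockTensor.
Arguments block_cat {k p I F G}.

Section BlockHom.
Variables (k : fieldType) (p q : species k) (a : sp_hom p q).

Fixpoint block_hom (I : finType) (F : seq {set I}) :
    {linear block_tens p F -> block_tens q F} :=
  match F with
  | [::] => idfun
  | A :: F' => tens_map (a (sub A)) (block_hom F')
  end.

Definition vec_hom I (u : block_vec p I) : block_vec q I :=
  Tagged (fun A : {set I} => q (sub A) : Type) (a _ (tagged u)).

Lemma block_hom_pure I (s : seq (block_vec p I)) :
  Tagged (fun F => block_tens q F : Type) (block_hom _ (pure s)) =
  Tagged (fun F => block_tens q F : Type) (pure (map (@vec_hom I) s)).
Proof. by elim: s => //= u s IHs; rewrite tens_mapE; exact: btag_cons. Qed.

Lemma tag_vec_hom I s : map tag (map (@vec_hom I) s) = map tag s.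
Proof. by rewrite -map_comp. Qed.

Lemma vec_hom_map S I (f : inj S I) u :
  vec_hom (vec_map f u) = vec_map f (vec_hom u).
Proof. by rewrite /vec_hom /vec_map /= sp_hom_nat. Qed.
End BlockHom.

Section FreeMonoid.
Variables (k : fieldType) (p : species k).

Definition free_obj (I : finType) : lmodType k :=
  dsum (fun F : comp I => block_tens p F).

Definition free_in I (F : comp I) : {linear block_tens p F -> free_obj I} :=
  dsum_in (fun F : comp I => block_tens p F) F.

Definition free_map I J (f : bij I J) : {linear free_obj I -> free_obj J} :=
  dsum_lift (fun F : comp I =>
    free_in (comp_im f F) \o block_map p (inj_of_bij f) F).

Definition free_pure I (s : seq (block_vec p I)) (h : is_comp (map tag s)) :
  free_obj I := free_in (Comp h) (pure s).

Lemma free_in_tagged I (F G : comp I) (x : block_tens p F) (y : block_tens p G) :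
  Tagged (fun F => block_tens p F : Type) x =
  Tagged (fun F => block_tens p F : Type) y ->
  free_in F x = free_in G y :> free_obj I.
Proof.
pose phi (u : {F : seq {set I} & block_tens p F : Type}) : free_obj I :=
  if is_comp (tag u) =P true is ReflectT h
  then free_in (Comp h) (tagged u) else 0.
have phiE (H : comp I) z : phi (Tagged (fun F => block_tens p F : Type) z) = free_in H z.
  rewrite /phi; case: H z => H h /= z; case: eqP => [h'|]; last by rewrite h.
  by rewrite (bool_irrelevance h' h).
by move=> /(congr1 phi); rewrite !phiE.
Qed.

Lemma free_pure_eq I (s t : seq (block_vec p I)) h h' :
  s = t -> @free_pure I s h = @free_pure I t h'.
Proof. by move=> st; subst t; rewrite (bool_irrelevance h h'). Qed.

Lemma free_ind I (P : free_obj I -> Prop) :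
    P 0 -> (forall a x y, P x -> P y -> P (a *: x + y)) ->
    (forall s h, P (@free_pure I s h)) ->
  forall x, P x.
Proof.
move=> P0 PD Ppure x; rewrite [x]dsum_sumE.
apply: big_ind => // [y z Py Pz|F _]; first by rewrite -[y]scale1r; apply: (PD).
elim/block_ind: (x F) => {x} [|a x y Px Py|s e]; first by rewrite linear0.
  by rewrite linearP; apply: (PD).
case: F e => F h /= e; subst F; exact: Ppure.
Qed.

Lemma free_ext (I : finType) (V : lmodType k) (f g : free_obj I -> V) :
  linear f -> linear g ->
  (forall s h, f (@free_pure I s h) = g (@free_pure I s h)) -> f =1 g.
Proof.
move=> fl gl fg; elim/free_ind=> [|a x y fx fy|s h]; last exact: fg.
  by rewrite -(pack_linearE fl) -(pack_linearE gl) !linear0.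
by rewrite fl gl fx fy.
Qed.

Lemma free_map_pure I J (f : bij I J) s h h' :
  free_map f (@free_pure I s h) =
  @free_pure J (map (vec_map (inj_of_bij f)) s) h'.
Proof.
rewrite /free_map /free_pure dsum_lift_in; apply: free_in_tagged.
exact: (block_map_pure (inj_of_bij f) s).
Qed.

Lemma is_comp_vec_map I J (f : bij I J) (s : seq (block_vec p I)) :
  is_comp (map tag s) -> is_comp (map tag (map (vec_map (inj_of_bij f)) s)).
Proof. by move=> h; rewrite tag_vec_map; exact: (is_comp_im f (Comp h)). Qed.

Lemma free_map_id I x : free_map (bij_id I) x = x.
Proof.
apply: (free_ext (f := free_map _) (g := id)) x => // [|s h].
  exact: linearP.
rewrite (free_map_pure _ (is_comp_vec_map _ h)); apply: free_pure_eq.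
by rewrite -[RHS]map_id; apply: eq_map; exact: vec_map_id.
Qed.

Lemma free_map_comp I J L (g : bij J L) (f : bij I J) x :
  free_map (comp_bij g f) x = free_map g (free_map f x).
Proof.
apply: (free_ext (f := free_map _) (g := free_map g \o free_map f)) x.
- exact: linearP.
- exact: linearP.
move=> s h /=; have h1 := is_comp_vec_map f h.
rewrite (free_map_pure _ (is_comp_vec_map _ h)) (free_map_pure _ h1).
rewrite (free_map_pure _ (is_comp_vec_map g h1)).
apply: free_pure_eq; rewrite -map_comp; apply: eq_map => u.
exact/esym/vec_map_comp1.
Qed.

Definition free_sp : species k := Species free_map_id free_map_comp.

(* The sum over F and G of the canonical isomorphisms
   p(F) (x) p(G) -> p(F . G). *)
Definition free_mul S T I (d : decomp S T I) (x : free_obj S) (y : free_obj T) :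
  free_obj I :=
  \sum_(F : comp S) \sum_(G : comp T)
    free_in (comp_cat d F G)
      (block_cat (block_map p (incl d) F (x F) *t
                 block_map p (incr d) G (y G))).

Lemma free_mul_bilinear S T I (d : decomp S T I) :
  bilinear_for *:%R *:%R (free_mul d).
Proof.
split=> [y a x x'|x a y y'] /=; rewrite /free_mul scaler_sumr -big_split /=;
  apply: eq_bigr => F _; rewrite scaler_sumr -big_split /=;
  apply: eq_bigr => G _; rewrite dsumDE dsumZE.
  by rewrite linearP linearPl !linearP.
by rewrite linearP linearPr !linearP.
Qed.

Definition free_mu S T I (d : decomp S T I) :
    {linear free_obj S \ox free_obj T -> free_obj I} :=
  tens_lift (pack_bilinear (free_mul_bilinear d)).

Definition free_unit : {linear k^o -> free_obj fin0} := free_in comp_nil.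

Lemma is_comp_vec_cat S T I (d : decomp S T I) s t :
  is_comp (map tag s) -> is_comp (map tag t) ->
  is_comp (map tag (map (@vec_map k p _ _ (incl d)) s ++
                    map (@vec_map k p _ _ (incr d)) t)).
Proof.
move=> hs ht; rewrite map_cat !tag_vec_map.
exact: (is_comp_cat d (Comp hs) (Comp ht)).
Qed.

Lemma free_mu_pure S T I (d : decomp S T I) s hs t ht h :
  free_mu d (@free_pure S s hs *t @free_pure T t ht) =
  @free_pure I (map (vec_map (incl d)) s ++ map (vec_map (incr d)) t) h.
Proof.
rewrite tens_liftE pack_bilinearE /free_mul (bigD1 (Comp hs)) //=.
rewrite [X in _ + X]big1 => [|F Fs]; last first.
  rewrite big1 // => G _; rewrite dsum_in_neq 1?eq_sym //.
  by rewrite linear0 linear0l !linear0.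
rewrite addr0 (bigD1 (Comp ht)) //= big1 => [|G Gt]; last first.
  rewrite [X in block_map _ (incr d) _ X]dsum_in_neq 1?eq_sym //.
  by rewrite linear0 linear0r !linear0.
rewrite addr0 /free_pure !dsum_in_id.
apply: (@free_in_tagged I (comp_cat d (Comp hs) (Comp ht)) (Comp h)).
rewrite -block_cat_pure.
pose phi (u v : {F : seq {set I} & block_tens p F : Type}) :=
  Tagged (fun F => block_tens p F : Type)
    (block_cat (tagged u *t tagged v)).
have := f_equal2 phi (block_map_pure (incl d) s) (block_map_pure (incr d) t).
exact.
Qed.

Lemma free_mu_nat S T I S' T' I' (d : decomp S T I) (d' : decomp S' T' I')
    (f : bij S S') (g : bij T T') (h : bij I I') :
  (forall s, h (incl d s) = incl d' (f s)) ->
  (forall t, h (incr d t) = incr d' (g t)) ->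
  forall z, free_map h (free_mu d z) =
            free_mu d' (tens_map (free_map f) (free_map g) z).
Proof.
move=> hf hg.
apply: (tens_ext (f := free_map h \o free_mu d)
  (g := free_mu d' \o tens_map (free_map f) (free_map g))) => x y /=.
rewrite tens_mapE.
apply: (free_ext (f := fun x => free_map h (free_mu d (x *t y)))
  (g := fun x => free_mu d' (free_map f x *t free_map g y))) x.
- by move=> a u v; rewrite !(linearP, linearPl).
- by move=> a u v; rewrite !(linearP, linearPl).
move=> s hs.
apply: (free_ext (f := fun y => free_map h (free_mu d (_ *t y)))
  (g := fun y => free_mu d' (free_map f _ *t free_map g y))) y.
- by move=> a u v; rewrite !(linearP, linearPr).
- by move=> a u v; rewrite !(linearP, linearPr).
move=> t ht.
have hst := is_comp_vec_cat d hs ht.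
have hs' := is_comp_vec_map f hs; have ht' := is_comp_vec_map g ht.
rewrite (free_mu_pure _ _ hst) (free_map_pure _ (is_comp_vec_map h hst)).
rewrite (free_map_pure _ hs') (free_map_pure _ ht').
rewrite (free_mu_pure _ _ (is_comp_vec_cat d' hs' ht')).
apply: free_pure_eq; rewrite map_cat -!map_comp; congr (_ ++ _).
  by apply: eq_map => u /=; exact: vec_map_comp.
by apply: eq_map => u /=; exact: vec_map_comp.
Qed.

Lemma free_mu_assoc R S T RS ST I (d1 : decomp R S RS) (d2 : decomp RS T I)
    (d3 : decomp S T ST) (d4 : decomp R ST I) :
  (forall r, incl d2 (incl d1 r) = incl d4 r) ->
  (forall s, incl d2 (incr d1 s) = incr d4 (incl d3 s)) ->
  (forall t, incr d2 t = incr d4 (incr d3 t)) ->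
  forall x y z, free_mu d2 (free_mu d1 (x *t y) *t z) =
                free_mu d4 (x *t free_mu d3 (y *t z)).
Proof.
move=> er es et x y z.
apply: (free_ext (f := fun x => free_mu d2 (free_mu d1 (x *t y) *t z))
  (g := fun x => free_mu d4 (x *t free_mu d3 (y *t z)))) x.
- by move=> a u v; rewrite !(linearP, linearPl).
- by move=> a u v; rewrite !(linearP, linearPl).
move=> r hr.
apply: (free_ext (f := fun y => free_mu d2 (free_mu d1 (_ *t y) *t z))
  (g := fun y => free_mu d4 (_ *t free_mu d3 (y *t z)))) y.
- by move=> a u v; rewrite linearPr linearP linearPl linearP.
- by move=> a u v; rewrite linearPl linearP linearPr linearP.
move=> s hs.
apply: (free_ext (f := fun z => free_mu d2 (free_mu d1 _ *t z))
  (g := fun z => free_mu d4 (_ *t free_mu d3 (_ *t z)))) z.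
- by move=> a u v; rewrite linearPr linearP.
- by move=> a u v; rewrite linearPr linearP linearPr linearP.
move=> t ht.
have h1 := is_comp_vec_cat d1 hr hs; have h3 := is_comp_vec_cat d3 hs ht.
rewrite (free_mu_pure _ _ h1) (free_mu_pure _ _ h3).
rewrite (free_mu_pure _ _ (is_comp_vec_cat d2 h1 ht)).
rewrite (free_mu_pure _ _ (is_comp_vec_cat d4 hr h3)).
apply: free_pure_eq; rewrite !map_cat -!map_comp -catA.
congr (_ ++ (_ ++ _)); apply: eq_map => u /=.
- exact: vec_map_comp1.
- exact: vec_map_comp.
- by apply/esym/vec_map_comp1 => v; rewrite et.
Qed.

Definition is_comp_vec_nil : is_comp (map tag ([::] : seq (block_vec p fin0))) :=
  is_comp_nil.

Lemma free_unitE : free_unit 1 = @free_pure fin0 [::] is_comp_vec_nil.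
Proof. by []. Qed.

Lemma free_unitl I (d : decomp fin0 I I) : incr d =1 id ->
  forall x, free_mu d (free_unit 1 *t x) = x.
Proof.
move=> did; rewrite free_unitE; apply: (free_ext (g := id)) => // [a u v|s h].
  by rewrite linearPr linearP.
rewrite (free_mu_pure _ _ (is_comp_vec_cat d is_comp_vec_nil h)).
apply: free_pure_eq => /=; rewrite -[RHS]map_id.
by apply: eq_map; exact: vec_map_id.
Qed.

Lemma free_unitr I (d : decomp I fin0 I) : incl d =1 id ->
  forall x, free_mu d (x *t free_unit 1) = x.
Proof.
move=> did; rewrite free_unitE; apply: (free_ext (g := id)) => // [a u v|s h].
  by rewrite linearPl linearP.
rewrite (free_mu_pure _ _ (is_comp_vec_cat d h is_comp_vec_nil)).
apply: free_pure_eq => /=; rewrite cats0 -[RHS]map_id.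
by apply: eq_map; exact: vec_map_id.
Qed.

(* The free monoid T(p). *)
Definition free_monoid : monoid k :=
  @Monoid k free_sp free_mu free_unit free_mu_nat free_mu_assoc
    free_unitl free_unitr.

End FreeMonoid.

Section FreeHom.
Variables (k : fieldType) (p q : species k) (a : sp_hom p q).

Definition free_hom_fun I : {linear free_obj p I -> free_obj q I} :=
  dsum_lift (fun F : comp I => free_in q F \o block_hom a F).

Lemma free_hom_pure I s h h' :
  free_hom_fun I (@free_pure k p I s h) =
  @free_pure k q I (map (@vec_hom k p q a I) s) h'.
Proof.
rewrite /free_hom_fun /free_pure dsum_lift_in; apply: free_in_tagged.
exact: (block_hom_pure a s).
Qed.

Lemma is_comp_vec_hom I s :
  is_comp (map tag s) -> is_comp (map tag (map (@vec_hom k p q a I) s)).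
Proof. by rewrite tag_vec_hom. Qed.

Lemma free_hom_nat I J (f : bij I J) x :
  free_hom_fun J (free_map p f x) = free_map q f (free_hom_fun I x).
Proof.
apply: (free_ext (f := free_hom_fun J \o free_map p f)
  (g := free_map q f \o free_hom_fun I)) x.
- exact: linearP.
- exact: linearP.
move=> s h /=; have h1 := is_comp_vec_map f h; have h2 := is_comp_vec_hom h.
rewrite (free_map_pure _ h1) (free_hom_pure _ (is_comp_vec_hom h1)).
rewrite (free_hom_pure _ h2) (free_map_pure _ (is_comp_vec_map f h2)).
apply: free_pure_eq; rewrite -!map_comp; apply: eq_map => u.
exact: vec_hom_map.
Qed.

Definition free_hom_sp : sp_hom (free_sp p) (free_sp q) :=
  @SpHom k (free_sp p) (free_sp q) free_hom_fun free_hom_nat.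

Lemma free_hom_mu S T I (d : decomp S T I) z :
  free_hom_fun I (free_mu p d z) =
  free_mu q d (tens_map (free_hom_fun S) (free_hom_fun T) z).
Proof.
apply: (tens_ext (f := free_hom_fun I \o free_mu p d)
  (g := free_mu q d \o tens_map (free_hom_fun S) (free_hom_fun T))) z => x y /=.
rewrite tens_mapE.
apply: (free_ext (f := fun x => free_hom_fun I (free_mu p d (x *t y)))
  (g := fun x => free_mu q d (free_hom_fun S x *t free_hom_fun T y))) x.
- by move=> c u v; rewrite !(linearP, linearPl).
- by move=> c u v; rewrite !(linearP, linearPl).
move=> s hs.
apply: (free_ext (f := fun y => free_hom_fun I (free_mu p d (_ *t y)))
  (g := fun y => free_mu q d (free_hom_fun S _ *t free_hom_fun T y))) y.
- by move=> c u v; rewrite !(linearP, linearPr).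
- by move=> c u v; rewrite !(linearP, linearPr).
move=> t ht; have hst := is_comp_vec_cat d hs ht.
have hs' := is_comp_vec_hom hs; have ht' := is_comp_vec_hom ht.
rewrite (free_mu_pure _ _ hst) (free_hom_pure _ (is_comp_vec_hom hst)).
rewrite (free_hom_pure _ hs') (free_hom_pure _ ht').
rewrite (free_mu_pure _ _ (is_comp_vec_cat d hs' ht')).
apply: free_pure_eq; rewrite map_cat -!map_comp; congr (_ ++ _);
  by apply: eq_map => u /=; exact: vec_hom_map.
Qed.

Lemma free_hom_unit c : free_hom_fun fin0 (free_unit p c) = free_unit q c.
Proof.
exact: (dsum_lift_in (fun F : comp fin0 => free_in q F \o block_hom a F)
  (i := comp_nil) c).
Qed.

Definition free_hom : mon_hom (free_monoid p) (free_monoid q) :=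
  @MonHom k (free_monoid p) (free_monoid q) free_hom_sp free_hom_mu free_hom_unit.

End FreeHom.

Section Star.
Variables (k : fieldType) (p q : species k).

(* The pairs (F, G) with F /\ G = (I); there is none when I is empty. *)
Definition star_pred (I : finType) (FG : comp I * comp I) : bool :=
  (0 < #|I|)%N && is_meet FG.1 FG.2 [:: [set: I]].

Definition star_idx (I : finType) : finType :=
  {FG : comp I * comp I | star_pred FG}.

Lemma star_pred_im I J (f : bij I J) (FG : star_idx I) :
  star_pred (comp_im f (val FG).1, comp_im f (val FG).2).
Proof.
case: FG => [[F G] /= /andP[/card_gt0P[x _] FG]]; apply/andP; split.
  by apply/card_gt0P; exists (f x).
have fT : f @: [set: I] = [set: J].
  have [g fK gK] := bijP f.
  by apply/setP=> y; rewrite inE -[y]gK; exact: imset_f.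
by have := is_meet_im (inj_of_bij f) FG; rewrite {3}/seq_im /= fT.
Qed.

Definition star_im I J (f : bij I J) (FG : star_idx I) : star_idx J :=
  exist _ (comp_im f (val FG).1, comp_im f (val FG).2) (star_pred_im f FG).

Definition star_comp (I : finType) (FG : star_idx I) : lmodType k :=
  block_tens p (val FG).1 \ox block_tens q (val FG).2.

Definition star_obj (I : finType) : lmodType k := dsum (@star_comp I).

Definition star_map I J (f : bij I J) : {linear star_obj I -> star_obj J} :=
  dsum_lift (fun FG : star_idx I =>
    dsum_in (@star_comp J) (star_im f FG) \o
      tens_map (block_map p (inj_of_bij f) (val FG).1)
               (block_map q (inj_of_bij f) (val FG).2)).

Definition star_pure I (s : seq (block_vec p I)) (t : seq (block_vec q I))
    (hs : is_comp (map tag s)) (ht : is_comp (map tag t))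
    (h : star_pred (Comp hs, Comp ht)) : star_obj I :=
  dsum_in (@star_comp I) (exist _ (Comp hs, Comp ht) h) (pure s *t pure t).

Lemma star_in_tagged I (FG FG' : star_idx I)
    (x : block_tens p (val FG).1) (y : block_tens q (val FG).2)
    (x' : block_tens p (val FG').1) (y' : block_tens q (val FG').2) :
  Tagged (fun F => block_tens p F : Type) x =
  Tagged (fun F => block_tens p F : Type) x' ->
  Tagged (fun F => block_tens q F : Type) y =
  Tagged (fun F => block_tens q F : Type) y' ->
  dsum_in (@star_comp I) FG (x *t y) = dsum_in (@star_comp I) FG' (x' *t y').
Proof.
pose phi (u : {F : seq {set I} & block_tens p F : Type})
    (v : {F : seq {set I} & block_tens q F : Type}) : star_obj I :=
  if is_comp (tag u) =P true is ReflectT hu then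
    if is_comp (tag v) =P true is ReflectT hv then
      if star_pred (Comp hu, Comp hv) =P true is ReflectT h then
        dsum_in (@star_comp I) (exist _ (Comp hu, Comp hv) h)
          (tagged u *t tagged v)
      else 0 else 0 else 0.
have phiE (H : star_idx I) z w :
    phi (Tagged (fun F => block_tens p F : Type) z)
        (Tagged (fun F => block_tens q F : Type) w) =
    dsum_in (@star_comp I) H (z *t w).
  rewrite /phi; case: H z w => [[[F hF] [G hG]] h] /= z w.
  case: eqP => [hF'|]; last by rewrite hF.
  case: eqP => [hG'|]; last by rewrite hG.
  rewrite (bool_irrelevance hF' hF) (bool_irrelevance hG' hG).
  case: eqP => [h'|]; last by rewrite h.
  by rewrite (bool_irrelevance h' h).
by move=> xx' yy'; have := f_equal2 phi xx' yy'; rewrite !phiE.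
Qed.

Lemma star_pure_eq I s s' t t' hs hs' ht ht' h h' :
  s = s' -> t = t' ->
  @star_pure I s t hs ht h = @star_pure I s' t' hs' ht' h'.
Proof.
move=> ss' tt'; apply: star_in_tagged => /=; first by rewrite ss'.
by rewrite tt'.
Qed.

Lemma star_ext (I : finType) (V : lmodType k) (f g : {linear star_obj I -> V}) :
  (forall s t hs ht h, f (@star_pure I s t hs ht h) =
                       g (@star_pure I s t hs ht h)) -> f =1 g.
Proof.
move=> fg; apply: dsum_ext => -[[F G] h].
apply: (tens_ext (f := f \o dsum_in _ _) (g := g \o dsum_in _ _)) => x y /=.
elim/block_ind: x => [|a x x' IHx IHx'|s e].
- by rewrite linear0l !linear0.
- by rewrite !(linearPl, linearP) IHx IHx'.
elim/block_ind: y => [|a y y' IHy IHy'|t e'].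
- by rewrite linear0r !linear0.
- by rewrite !(linearPr, linearP) IHy IHy'.
case: F G h e e' => [F hF] [G hG] h /= e e'; subst F; subst G.
exact: fg.
Qed.

Lemma star_map_pure I J (f : bij I J) s t hs ht h hs' ht' h' :
  star_map f (@star_pure I s t hs ht h) =
  @star_pure J (map (vec_map (inj_of_bij f)) s)
    (map (vec_map (inj_of_bij f)) t) hs' ht' h'.
Proof.
rewrite /star_map /star_pure dsum_lift_in /= tens_mapE.
apply: (@star_in_tagged J (star_im f (exist _ (Comp hs, Comp ht) h))
  (exist _ (Comp hs', Comp ht') h')) => /=.
  exact: (block_map_pure (inj_of_bij f) s).
exact: (block_map_pure (inj_of_bij f) t).
Qed.

Lemma star_pred_eq I (F G F' G' : comp I) :
  F = F' :> seq _ -> G = G' :> seq _ -> star_pred (F, G) -> star_pred (F', G').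
Proof. by move=> /val_inj -> /val_inj ->. Qed.

Lemma star_pred_vec_map I J (f : bij I J) s t hs ht
    (h : star_pred (@Comp I (map tag s) hs, @Comp I (map tag t) ht)) :
  star_pred (Comp (@is_comp_vec_map k p I J f s hs),
             Comp (@is_comp_vec_map k q I J f t ht)).
Proof.
have := star_pred_im f (exist _ (Comp hs, Comp ht) h).
by apply: star_pred_eq => /=; rewrite tag_vec_map.
Qed.

Lemma star_map_id I x : star_map (bij_id I) x = x.
Proof.
apply: (star_ext (f := star_map _) (g := idfun)) x => s t hs ht h.
rewrite (star_map_pure _ (star_pred_vec_map _ h)).
by apply: star_pure_eq; rewrite -[RHS]map_id; apply: eq_map; exact: vec_map_id.
Qed.

Lemma star_map_comp I J L (g : bij J L) (f : bij I J) x :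
  star_map (comp_bij g f) x = star_map g (star_map f x).
Proof.
apply: (star_ext (f := star_map _) (g := star_map g \o star_map f)) x.
move=> s t hs ht h /=; have h1 := star_pred_vec_map f h.
rewrite (star_map_pure _ (star_pred_vec_map _ h)) (star_map_pure _ h1).
rewrite (star_map_pure _ (star_pred_vec_map g h1)).
by apply: star_pure_eq; rewrite -map_comp; apply: eq_map => u;
  exact/esym/vec_map_comp1.
Qed.

Definition star_sp : species k := Species star_map_id star_map_comp.

Lemma star_positive : positive star_sp.
Proof.
move=> I I0 x; apply/ffunP=> FG.
by case/andP: (valP FG); rewrite I0.
Qed.

Definition star : pos_species k := PosSpecies star_positive.

End Star.

Section StarHom.
Variables (k : fieldType) (p p' q q' : species k).
Variables (a : sp_hom p p') (b : sp_hom q q').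

Definition star_hom_fun I : {linear star_obj p q I -> star_obj p' q' I} :=
  dsum_lift (fun FG : star_idx I =>
    dsum_in (@star_comp k p' q' I) FG \o
      tens_map (block_hom a (val FG).1) (block_hom b (val FG).2)).

Lemma star_hom_pure I s t hs ht h hs' ht' h' :
  star_hom_fun I (@star_pure k p q I s t hs ht h) =
  @star_pure k p' q' I (map (@vec_hom k p p' a I) s)
    (map (@vec_hom k q q' b I) t) hs' ht' h'.
Proof.
rewrite /star_hom_fun /star_pure dsum_lift_in /= tens_mapE.
apply: (@star_in_tagged k p' q' I (exist _ (Comp hs, Comp ht) h)
  (exist _ (Comp hs', Comp ht') h')) => /=.
  exact: (block_hom_pure a s).
exact: (block_hom_pure b t).
Qed.

Lemma star_pred_vec_hom I s t hs ht
    (h : star_pred (@Comp I (map tag s) hs, @Comp I (map tag t) ht)) :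
  star_pred (Comp (@is_comp_vec_hom k p p' a I s hs),
             Comp (@is_comp_vec_hom k q q' b I t ht)).
Proof. by apply: star_pred_eq h => /=; rewrite tag_vec_hom. Qed.

Lemma star_hom_nat I J (f : bij I J) x :
  star_hom_fun J (star_map p q f x) = star_map p' q' f (star_hom_fun I x).
Proof.
apply: (star_ext (f := star_hom_fun J \o star_map p q f)
  (g := star_map p' q' f \o star_hom_fun I)) x => s t hs ht h /=.
have h1 := star_pred_vec_map f h; have h2 := star_pred_vec_hom h.
rewrite (star_map_pure _ h1) (star_hom_pure _ (star_pred_vec_hom h1)).
rewrite (star_hom_pure _ h2) (star_map_pure _ (star_pred_vec_map f h2)).
by apply: star_pure_eq; rewrite -!map_comp; apply: eq_map => u;
  exact: vec_hom_map.
Qed.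

Definition star_hom : sp_hom (star p q) (star p' q') :=
  @SpHom k (star_sp p q) (star_sp p' q') star_hom_fun star_hom_nat.

End StarHom.

Section Hadamard.
Variables (k : fieldType) (M N : monoid k).

Definition had_obj (I : finType) : lmodType k := M I \ox N I.

Definition had_map I J (f : bij I J) : {linear had_obj I -> had_obj J} :=
  tens_map (sp_map M f) (sp_map N f).

Lemma had_map_id I x : had_map (bij_id I) x = x.
Proof.
apply: (tens_ext (f := had_map _) (g := idfun)) x => v w.
by rewrite tens_mapE !sp_map_id.
Qed.

Lemma had_map_comp I J L (g : bij J L) (f : bij I J) x :
  had_map (comp_bij g f) x = had_map g (had_map f x).
Proof.
apply: (tens_ext (f := had_map _) (g := had_map g \o had_map f)) x => v w /=.
by rewrite !tens_mapE !sp_map_comp.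
Qed.

Definition had_sp : species k := Species had_map_id had_map_comp.

Definition had_mu S T I (d : decomp S T I) :
    {linear had_obj S \ox had_obj T -> had_obj I} :=
  tens_map (mu M d) (mu N d) \o tens_switch (M S) (N S) (M T) (N T).

(* Under k = k (x) k, the scalar c is c (x) 1. *)
Lemma had_unit_is_linear :
  linear (fun c => mon_unit M c *t mon_unit N 1 : had_obj fin0).
Proof. by move=> a c c'; rewrite linearP linearPl. Qed.

Definition had_unit : {linear k^o -> had_obj fin0} :=
  pack_linear had_unit_is_linear.

Lemma had_muE S T I (d : decomp S T I) x y z w :
  had_mu d ((x *t y) *t (z *t w)) = mu M d (x *t z) *t mu N d (y *t w).
Proof. by rewrite /= tens_switchE tens_mapE. Qed.

Lemma tens_ext1 (V W Z : lmodType k) (f g : V \ox W -> Z) :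
  linear f -> linear g -> (forall v w, f (v *t w) = g (v *t w)) -> f =1 g.
Proof.
move=> fl gl fg x; rewrite -(pack_linearE fl) -(pack_linearE gl).
by apply: tens_ext => v w; rewrite !pack_linearE.
Qed.

Lemma had_mu_nat S T I S' T' I' (d : decomp S T I) (d' : decomp S' T' I')
    (f : bij S S') (g : bij T T') (h : bij I I') :
  (forall s, h (incl d s) = incl d' (f s)) ->
  (forall t, h (incr d t) = incr d' (g t)) ->
  forall z, had_map h (had_mu d z) =
            had_mu d' (tens_map (had_map f) (had_map g) z).
Proof.
move=> hf hg z.
apply: (tens_ext (f := had_map h \o had_mu d)
  (g := had_mu d' \o tens_map (had_map f) (had_map g))) z => x y.
rewrite -[LHS]/(had_map h (had_mu d (x *t y))).
rewrite -[RHS]/(had_mu d' (tens_map (had_map f) (had_map g) (x *t y))).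
rewrite tens_mapE.
apply: (tens_ext1 (f := fun x => had_map h (had_mu d (x *t y)))
  (g := fun x => had_mu d' (had_map f x *t had_map g y))) x.
- by move=> a u v; rewrite linearPl !linearP.
- by move=> a u v; rewrite linearP linearPl linearP.
move=> x1 x2.
apply: (tens_ext1 (f := fun y => had_map h (had_mu d (_ *t y)))
  (g := fun y => had_mu d' (had_map f _ *t had_map g y))) y.
- by move=> a u v; rewrite linearPr !linearP.
- by move=> a u v; rewrite linearP linearPr linearP.
move=> y1 y2.
by rewrite had_muE !tens_mapE had_muE !(mu_nat hf hg) !tens_mapE.
Qed.

Lemma had_mu_assoc R S T RS ST I (d1 : decomp R S RS) (d2 : decomp RS T I)
    (d3 : decomp S T ST) (d4 : decomp R ST I) :
  (forall r, incl d2 (incl d1 r) = incl d4 r) ->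
  (forall s, incl d2 (incr d1 s) = incr d4 (incl d3 s)) ->
  (forall t, incr d2 t = incr d4 (incr d3 t)) ->
  forall x y z, had_mu d2 (had_mu d1 (x *t y) *t z) =
                had_mu d4 (x *t had_mu d3 (y *t z)).
Proof.
move=> er es et x y z.
apply: (tens_ext1 (f := fun x => had_mu d2 (had_mu d1 (x *t y) *t z))
  (g := fun x => had_mu d4 (x *t had_mu d3 (y *t z)))) x.
- by move=> a u v; rewrite linearPl linearP linearPl linearP.
- by move=> a u v; rewrite linearPl linearP.
move=> x1 x2.
apply: (tens_ext1 (f := fun y => had_mu d2 (had_mu d1 (_ *t y) *t z))
  (g := fun y => had_mu d4 (_ *t had_mu d3 (y *t z)))) y.
- by move=> a u v; rewrite linearPr linearP linearPl linearP.
- by move=> a u v; rewrite linearPl linearP linearPr linearP.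
move=> y1 y2.
apply: (tens_ext1 (f := fun z => had_mu d2 (had_mu d1 _ *t z))
  (g := fun z => had_mu d4 (_ *t had_mu d3 (_ *t z)))) z.
- by move=> a u v; rewrite linearPr linearP.
- by move=> a u v; rewrite linearPr linearP linearPr linearP.
move=> z1 z2.
by rewrite !had_muE !(mu_assoc er es et).
Qed.

Lemma had_unitl I (d : decomp fin0 I I) : incr d =1 id ->
  forall x, had_mu d (had_unit 1 *t x) = x.
Proof.
move=> did; rewrite /had_unit pack_linearE.
apply: (tens_ext1 (g := id)) => // [a u v|x1 x2].
  by rewrite linearPr linearP.
by rewrite had_muE !mu_unitl.
Qed.

Lemma had_unitr I (d : decomp I fin0 I) : incl d =1 id ->
  forall x, had_mu d (x *t had_unit 1) = x.
Proof.
move=> did; rewrite /had_unit pack_linearE.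
apply: (tens_ext1 (g := id)) => // [a u v|x1 x2].
  by rewrite linearPl linearP.
by rewrite had_muE !mu_unitr.
Qed.

Definition hadamard : monoid k :=
  @Monoid k had_sp had_mu had_unit had_mu_nat had_mu_assoc had_unitl had_unitr.

End Hadamard.

Section HadamardHom.
Variables (k : fieldType) (M M' N N' : monoid k).
Variables (a : mon_hom M M') (b : mon_hom N N').

Definition had_hom_fun I : {linear had_obj M N I -> had_obj M' N' I} :=
  tens_map (a I) (b I).

Lemma had_hom_nat I J (f : bij I J) x :
  had_hom_fun J (had_map M N f x) = had_map M' N' f (had_hom_fun I x).
Proof.
apply: (tens_ext (f := had_hom_fun J \o had_map M N f)
  (g := had_map M' N' f \o had_hom_fun I)) x => v w /=.
by rewrite !tens_mapE !sp_hom_nat.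
Qed.

Definition had_hom_sp : sp_hom (had_sp M N) (had_sp M' N') :=
  @SpHom k (had_sp M N) (had_sp M' N') had_hom_fun had_hom_nat.

Lemma had_hom_mu S T I (d : decomp S T I) z :
  had_hom_fun I (had_mu M N d z) =
  had_mu M' N' d (tens_map (had_hom_fun S) (had_hom_fun T) z).
Proof.
apply: (tens_ext1 (f := fun z => had_hom_fun I (had_mu M N d z))
  (g := fun z => had_mu M' N' d (tens_map (had_hom_fun S) (had_hom_fun T) z))) z.
- by move=> c u v; rewrite !linearP.
- by move=> c u v; rewrite !linearP.
move=> x y; rewrite tens_mapE.
apply: (tens_ext1 (f := fun x => had_hom_fun I (had_mu M N d (x *t y)))
  (g := fun x => had_mu M' N' d (had_hom_fun S x *t had_hom_fun T y))) x.
- by move=> c u v; rewrite linearPl !linearP.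
- by move=> c u v; rewrite linearP linearPl linearP.
move=> x1 x2.
apply: (tens_ext1 (f := fun y => had_hom_fun I (had_mu M N d (_ *t y)))
  (g := fun y => had_mu M' N' d (had_hom_fun S _ *t had_hom_fun T y))) y.
- by move=> c u v; rewrite linearPr !linearP.
- by move=> c u v; rewrite linearP linearPr linearP.
move=> y1 y2.
by rewrite had_muE /had_hom_fun !tens_mapE had_muE !mon_hom_mu !tens_mapE.
Qed.

Lemma had_hom_unit c : had_hom_fun fin0 (had_unit M N c) = had_unit M' N' c.
Proof.
rewrite /had_unit !(pack_linearE (had_unit_is_linear _ _)).
by rewrite -(mon_hom_unit a) -(mon_hom_unit b); exact: tens_mapE.
Qed.

Definition had_hom : mon_hom (hadamard M N) (hadamard M' N') :=
  @MonHom k (hadamard M N) (hadamard M' N') had_hom_sp had_hom_mu had_hom_unit.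

End HadamardHom.

(* Main.v *)
From mathcomp Require Import all_boot all_algebra.
From mathcomp Require Import boolp.
Require Import Defs.

Set Implicit Arguments.
Unset Strict Implicit.
Unset Printing Implicit Defensive.

Import GRing.Theory.
Local Open Scope ring_scope.

(** The monoid T(p) is free on p: a map of species from p to a monoid M has a
unique extension to a morphism of monoids from T(p) to M, which multiplies in M
the images of the factors of each p(F) ([ext_hom], [ext_gen],
[free_hom_unique]). The map

  (p star q)[I] -> T(p)[I] (x) T(q)[I]

which includes the summand p(F) (x) q(G), for F /\ G = (I), in the direct sum of
all the p(F) (x) q(G) therefore extends to a morphism [comparison] from
T(p star q) to T(p) x T(q). Naturality in p and q is an equality of two morphisms
out of a free monoid, so it is enough to see it on generators
([comparison_natural]).

The comparison is bijective because a pair of compositions (F, G) is the same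
thing as a composition H = (B_1, ..., B_m) together with pairs (F_i, G_i) of
compositions of the blocks B_i such that F_i /\ G_i = (B_i): H is F /\ G, and F_i
and G_i are the restrictions of F and G to B_i.

Surjectivity is proved by induction on I ([comparison_pure_surj]): if
F /\ G = (I), a pure tensor in p(F) (x) q(G) is the image of a generator;
otherwise the flags of F and G have a common proper member X, the pure tensor is
a product of a tensor on X and one on the complement of X, and the image of a
morphism is closed under products.

For injectivity, the inverse is given by an explicit formula on pure tensors
([inv_pure]): cut both tensors along the blocks of F /\ G. The formula is linear
in each factor, hence defines a linear map ([free_lift2]). It undoes the
comparison on the products of generators that are pure tensors, and those
span T(p star q) ([recoverable_step], [recoverable_span]). What is needed of flags
is that a composition is determined by its flag ([flag_inj]) and that meets are
compatible with concatenation ([is_meet_cat]). The inverse of a bijective morphism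
is again a morphism ([mon_iso_bijective]). *)

Local Notation bvec p v := (Tagged (fun A : {set _} => p (sub A) : Type) v).

(** * Injections, bijections and decompositions *)

Definition id_inj (I : finType) : inj I I := Inj (@inj_id I).

Definition comp_inj (I J L : finType) (g : inj J L) (f : inj I J) : inj I L :=
  Inj (inj_comp (@injP _ _ g) (@injP _ _ f)).

Definition sub_inj (I : finType) (A : {set I}) : inj (sub A) I :=
  Inj (@val_inj _ (fun x => x \in A) (sub A)).

Lemma sub_bij_exists (I J : finType) (h : inj I J) (X : {set I}) (Y : {set J}) :
  h @: X = Y -> exists b : bij (sub X) (sub Y), forall x, val (b x) = h (val x).
Proof. by move=> <-; exists (restr h X). Qed.

Lemma empty_bij_bijective (I : finType) :
  #|I| = 0%N -> bijective (fun x : fin0 => match x with end : I).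
Proof.
move=> I0; have no (y : I) : False by have := fintype0 y; rewrite I0.
by exists (fun y => match no y with end) => y; case: (no y) || case: y.
Qed.

Definition empty_bij (I : finType) (I0 : #|I| = 0%N) : bij fin0 I :=
  Bij (empty_bij_bijective I0).

(** The complement of [A] in the range of [j] is kept as a subset of [J], so that
[ext_block] below can go on with an injection into the same set [I]. *)
Section Cut.
Variables (I J : finType) (j : inj J I) (A : {set I}).
Hypothesis jA : A \subset codom j.

Definition cut_incl_fun (x : sub A) : J := iinv (subsetP jA _ (valP x)).

Lemma cut_inclK x : j (cut_incl_fun x) = val x.
Proof. exact: f_iinv. Qed.

Lemma cut_incl_inj : injective cut_incl_fun.
Proof. by move=> x y /(congr1 j); rewrite !cut_inclK => /val_inj. Qed.

Lemma cut_incl_range : [set cut_incl_fun x | x : sub A] = j @^-1: A.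
Proof.
apply/setP=> y; rewrite inE; apply/imsetP/idP => [[x _ ->]|yA].
  by rewrite cut_inclK; exact: valP.
by exists (exist _ (j y) yA) => //; apply: (@injP _ _ j); rewrite cut_inclK.
Qed.

Lemma sub_inj_range (B : {set J}) : [set sub_inj B x | x : sub B] = B.
Proof.
apply/setP=> y; apply/imsetP/idP => [[x _ ->]|yB]; first exact: valP.
by exists (exist _ y yB).
Qed.

Definition cut_decomp : decomp (sub A) (sub (~: (j @^-1: A))) J.
Proof.
apply: (@Decomp _ _ _ (Inj cut_incl_inj) (sub_inj (~: (j @^-1: A)))).
  by rewrite cut_incl_range sub_inj_range setUCr.
by rewrite cut_incl_range sub_inj_range -setI_eq0 setICr.
Defined.

Lemma cut_inclE x : j (incl cut_decomp x) = val x.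
Proof. exact: cut_inclK. Qed.

Lemma cut_incrE x : incr cut_decomp x = val x.
Proof. by []. Qed.
End Cut.

Section DecompFacts.
Variables (S T I : finType) (d : decomp S T I).

Lemma decomp_incr_neq_incl s t : incr d t <> incl d s.
Proof.
move=> ts; have sd : incl d s \in [set incl d s | s : S] by exact: imset_f.
by have := disjointFr (decomp_disj d) sd; rewrite -ts imset_f.
Qed.

Lemma decompP x : (exists s, x = incl d s) \/ (exists t, x = incr d t).
Proof.
have := in_setT x; rewrite -(decomp_cover d) inE.
by case/orP=> /imsetP[y _ ->]; [left|right]; exists y.
Qed.

Lemma incr_bijective : #|S| = 0%N -> bijective (incr d).
Proof.
move=> S0; apply: (inj_card_bij (@injP _ _ (incr d))).
have <- : #|[set incr d t | t : T]| = #|I|.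
  rewrite -cardsT -(decomp_cover d); apply: eq_card => x.
  rewrite inE orbC; case: (boolP (x \in [set incr d t | t : T])) => //= _.
  by apply/esym/imsetP => -[s]; have := fintype0 s; rewrite S0.
exact: leq_imset_card.
Qed.
End DecompFacts.

(** The associativity axiom of monoids speaks of four decompositions; in an
induction only the three that appear here are at hand. *)
Lemma decomp_assoc (R S T RS ST I : finType) (d1 : decomp R S RS)
    (d2 : decomp RS T I) (d4 : decomp R ST I) :
  (forall r, incl d2 (incl d1 r) = incl d4 r) ->
  exists d3 : decomp S T ST,
    (forall s, incl d2 (incr d1 s) = incr d4 (incl d3 s)) /\
    (forall t, incr d2 t = incr d4 (incr d3 t)).
Proof.
move=> er.
have exS s : exists x, incl d2 (incr d1 s) = incr d4 x.
  case: (decompP d4 (incl d2 (incr d1 s))) => [[r]|//].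
  by rewrite -er => /(@injP _ _ (incl d2)) /decomp_incr_neq_incl.
have exT t : exists x, incr d2 t = incr d4 x.
  case: (decompP d4 (incr d2 t)) => [[r]|//].
  by rewrite -er => /decomp_incr_neq_incl.
have [gS gSE] := choice exS; have [gT gTE] := choice exT.
have gSi : injective gS.
  move=> s s' /(congr1 (incr d4)); rewrite -!gSE.
  by move/(@injP _ _ (incl d2))/(@injP _ _ (incr d1)).
have gTi : injective gT.
  by move=> t t' /(congr1 (incr d4)); rewrite -!gTE => /(@injP _ _ (incr d2)).
have cov : [set Inj gSi s | s : S] :|: [set Inj gTi t | t : T] = [set: ST].
  apply/setP=> x; rewrite !inE; apply/orP.
  case: (decompP d2 (incr d4 x)) => [[rs xrs]|[t xt]]; last first.
    right; apply/imsetP; exists t => //.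
    by apply: (@injP _ _ (incr d4)); rewrite xt gTE.
  case: (decompP d1 rs) => [[r rsr]|[s rss]].
    by move: xrs; rewrite rsr er => /decomp_incr_neq_incl.
  left; apply/imsetP; exists s => //.
  by apply: (@injP _ _ (incr d4)); rewrite xrs rss gSE.
have dis : [disjoint [set Inj gSi s | s : S] & [set Inj gTi t | t : T]].
  rewrite -setI_eq0; apply/eqP/setP=> x; rewrite !inE.
  apply/negP=> /andP[/imsetP[s _ ->] /imsetP[t _ /(congr1 (incr d4)) /=]].
  by rewrite -gSE -gTE => /esym/decomp_incr_neq_incl.
by exists (Decomp cov dis).
Qed.

Lemma decomp_sym_cover (S T I : finType) (d : decomp S T I) :
  [set incr d t | t : T] :|: [set incl d s | s : S] = [set: I].
Proof. by rewrite setUC decomp_cover. Qed.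

Lemma decomp_sym_disj (S T I : finType) (d : decomp S T I) :
  [disjoint [set incr d t | t : T] & [set incl d s | s : S]].
Proof. by rewrite disjoint_sym decomp_disj. Qed.

Definition decomp_sym (S T I : finType) (d : decomp S T I) : decomp T S I :=
  Decomp (decomp_sym_cover d) (decomp_sym_disj d).

Section EmptyDecomp.
Variable I : finType.

Lemma void_inj_injective : injective (fun x : fin0 => match x with end : I).
Proof. by case. Qed.

Lemma empty_decomp_cover :
  [set Inj void_inj_injective x | x : fin0] :|: [set id_inj I x | x : I] = [set: I].
Proof.
by apply/setP=> x; rewrite !inE; apply/orP; right; apply/imsetP; exists x.
Qed.

Lemma empty_decomp_disj :
  [disjoint [set Inj void_inj_injective x | x : fin0] & [set id_inj I x | x : I]].
Proof.
rewrite -setI_eq0; apply/eqP/setP=> x; rewrite !inE.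
by apply/negP=> /andP[/imsetP[[]]].
Qed.

Definition empty_decomp : decomp fin0 I I :=
  Decomp empty_decomp_cover empty_decomp_disj.
End EmptyDecomp.

(** * The unit of a monoid on an arbitrary empty set *)

Section UnitAt.
Variables (k : fieldType) (M : monoid k).

(** The unit element of a monoid lives on one particular empty set. Moving it to
all of them, and setting it to 0 on nonempty sets, gives an element of every
[M I]. *)
Definition unit_at (I : finType) : M I :=
  if #|I| =P 0%N is ReflectT I0 then sp_map M (empty_bij I0) (mon_unit M 1)
  else 0.

Lemma unit_at_map (I J : finType) (h : bij I J) :
  sp_map M h (unit_at I) = unit_at J.
Proof.
have IJ : #|I| = #|J| := bij_eq_card (bijP h).
rewrite /unit_at; case: eqP => [I0|I1]; case: eqP => [J0|J1] //.
- rewrite -sp_map_comp; congr (sp_map M _ _).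
  by apply: bij_ext; case.
- by case: J1; rewrite -IJ.
- by case: I1; rewrite IJ.
- by rewrite linear0.
Qed.

Lemma unit_at_fin0 : unit_at fin0 = mon_unit M 1.
Proof.
rewrite /unit_at; case: eqP => [I0|]; last by rewrite card_void.
by rewrite -[RHS]sp_map_id; congr (sp_map M _ _); apply: bij_ext; case.
Qed.

Lemma mu_unit_at_l (S T I : finType) (d : decomp S T I) (h : bij T I) y :
  #|S| = 0%N -> h =1 incr d -> mu M d (unit_at S *t y) = sp_map M h y.
Proof.
move=> S0 hd.
have := @mu_nat k M _ _ _ _ _ _ (empty_decomp T) d (empty_bij S0) (bij_id T) h
  _ _ (mon_unit M 1 *t y).
by rewrite mu_unitl // tens_mapE sp_map_id -unit_at_fin0 unit_at_map => ->.
Qed.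

Lemma mu_unit_at_r (S T I : finType) (d : decomp S T I) (h : bij S I) x :
  #|T| = 0%N -> h =1 incl d -> mu M d (x *t unit_at T) = sp_map M h x.
Proof.
move=> T0 hd.
have := @mu_nat k M _ _ _ _ _ _ (decomp_sym (empty_decomp S)) d (bij_id S)
  (empty_bij T0) h _ _ (x *t mon_unit M 1).
by rewrite mu_unitr // tens_mapE sp_map_id -unit_at_fin0 unit_at_map => ->.
Qed.

End UnitAt.

(** * Extension of a map of species to the free monoid *)

Section Extension.
Variables (k : fieldType) (p : species k) (M : monoid k) (f : sp_hom p M).

(** The product in [M], in order, of the images under [f] of the factors of
[p(F)]. It lives on the union of the blocks of [F], presented as the range of an
injection [j] from some set [J] rather than as a subset of [I]: for [F] a
composition of [I], taking [j] to be the identity gives a product in [M I]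
itself, not in [M] of the full subset of [I]. *)
Fixpoint ext_block (I : finType) (F : seq {set I}) :
    forall J : finType, inj J I -> {linear block_tens p F -> M J} :=
  match F with
  | [::] => fun J _ => pack_linear (scale_is_linear (unit_at M J))
  | A :: F' => fun J j =>
      if A \subset codom j =P true is ReflectT jA then
        mu M (cut_decomp jA) \o
          tens_map (f (sub A)) (ext_block F' (comp_inj j (sub_inj _)))
      else \0
  end.

Arguments ext_block {I F J} j.

Lemma ext_block_nil (I J : finType) (j : inj J I) c :
  ext_block (F := [::]) j c = c *: unit_at M J.
Proof. by rewrite /= pack_linearE. Qed.

Lemma ext_block_cons (I J : finType) (A : {set I}) F (j : inj J I)
    (jA : A \subset codom j) v x :
  ext_block (F := A :: F) j (v *t x) =
  mu M (cut_decomp jA)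
    (f (sub A) v *t ext_block (comp_inj j (sub_inj (~: (j @^-1: A)))) x).
Proof.
rewrite /=; case: eqP => [jA'|]; last by rewrite jA.
by rewrite /= tens_mapE (bool_irrelevance jA' jA).
Qed.

Lemma ext_block_cons0 (I J : finType) (A : {set I}) F (j : inj J I) x :
  ~~ (A \subset codom j) -> ext_block (F := A :: F) j x = 0.
Proof. by move=> jA; rewrite /=; case: eqP => // jA'; rewrite jA' in jA. Qed.

(** Naturality is needed for injections, not only for bijections, because the
product of [T(p)] moves tensors along the inclusions of [S] and [T] in their
disjoint union. *)
Lemma ext_block_nat (S I J L : finType) (g : inj S I) (F : seq {set S})
    (j : inj J S) (l : inj L I) (h : bij J L) :
  (forall y, l (h y) = g (j y)) -> forall x,
  ext_block l (block_map p g F x) = sp_map M h (ext_block j x).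
Proof.
elim: F J L j l h => [|A F IHF] J L j l h lh x.
  by rewrite !ext_block_nil linearZ /= unit_at_map.
have [h' hK hK'] := bijP h.
have lP y : (l y \in g @: A) = (j (h' y) \in A).
  by rewrite -{1}[y]hK' lh mem_imset //; exact: injP.
have sub_iff : (g @: A \subset codom l) = (A \subset codom j).
  apply/subsetP/subsetP => [gAl y yA|Aj _ /imsetP[y yA ->]].
    have /codomP[z yz] := gAl _ (imset_f g yA).
    by move: yz; rewrite -[z]hK' lh => /(@injP _ _ g) ->; rewrite codom_f.
  by have /codomP[z ->] := Aj _ yA; rewrite -lh codom_f.
case: (boolP (A \subset codom j)) => jA; last first.
  by rewrite !ext_block_cons0 ?linear0 // sub_iff.
have lA := jA; rewrite -sub_iff in lA.
apply: (tens_ext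
  (f := ext_block (F := g @: A :: _) l \o block_map p g (A :: F))
  (g := sp_map M h \o ext_block (F := A :: F) j)) x => v w.
rewrite -[LHS]/(ext_block (F := g @: A :: seq_im g F) l
  (tens_map (sp_map p (restr g A)) (block_map p g F) (v *t w))).
rewrite -[RHS]/(sp_map M h (ext_block (F := A :: F) j (v *t w))).
rewrite tens_mapE (ext_block_cons lA) (ext_block_cons jA).
have [] := @sub_bij_exists _ _ (inj_of_bij h)
  (~: (j @^-1: A)) (~: (l @^-1: (g @: A))).
  apply/setP=> y; rewrite -{1}[y]hK' mem_imset; last exact: (@injP _ _ (inj_of_bij h)).
  by rewrite !inE lP.
move=> b bh.
rewrite (mu_nat (d' := cut_decomp lA) (f := restr g A) (g := b)) => [|s|t].
- rewrite tens_mapE (sp_hom_nat f) (IHF _ _ (comp_inj j (sub_inj _)) _ b) //.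
  by move=> y /=; rewrite bh -lh.
- by apply: (@injP _ _ l); rewrite lh !cut_inclE.
- by rewrite !cut_incrE bh.
Qed.

(** The lists of blocks of the two tensors are in general only provably equal. *)
Lemma ext_block_tagged (I J : finType) (j : inj J I) (F G : seq {set I})
    (x : block_tens p F) (y : block_tens p G) :
  Tagged (fun F => block_tens p F : Type) x =
  Tagged (fun F => block_tens p F : Type) y ->
  ext_block j x = ext_block j y.
Proof.
exact: (congr1 (fun u : {F : seq {set I} & block_tens p F : Type} =>
  ext_block j (tagged u))).
Qed.

Lemma ext_block_reindex (I J L : finType) (F : seq {set I})
    (j : inj J I) (l : inj L I) (h : bij J L) :
  (forall y, l (h y) = j y) -> forall x : block_tens p F,
  ext_block l x = sp_map M h (ext_block j x).
Proof.
move=> lh x; rewrite -(@ext_block_nat _ _ _ _ (id_inj I) _ _ l h) //.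
elim/block_ind: x => [|a x y IHx IHy|s e]; first by rewrite !linear0.
  by rewrite !linearP IHx IHy.
subst F; apply: ext_block_tagged; rewrite block_map_pure.
by rewrite (eq_map (vec_map_id _)) ?map_id.
Qed.

(** The hypothesis on [F] says that its blocks are disjoint with union the
range of [j]. *)
Lemma ext_block_cat (I : finType) (F G : seq {set I}) (J K L : finType)
    (j : inj J I) (m : inj K I) (l : inj L I) (d : decomp J K L) :
  (forall y, l (incl d y) = j y) -> (forall y, l (incr d y) = m y) ->
  (forall x, count (fun A : {set I} => x \in A) F = (x \in codom j)) ->
  forall (x : block_tens p F) (y : block_tens p G),
  ext_block l (block_catl F y x) = mu M d (ext_block j x *t ext_block m y).
Proof.
elim: F J L j l d => [|A F IHF] J L j l d lj lm Fj x y.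
  have J0 : #|J| = 0%N.
    by apply: eq_card0 => z; have := Fj (j z); rewrite codom_f.
  rewrite ext_block_nil /= pack_linearE linearZ /= linearZl_LR linearZ /=.
  pose h := Bij (incr_bijective d J0).
  rewrite (mu_unit_at_l (h := h)) //; congr (_ *: _).
  by apply: ext_block_reindex => z; rewrite -lm.
have jA : A \subset codom j.
  by apply/subsetP=> z zA; move: (Fj z); rewrite /= zA; case: (z \in codom j).
have lA : A \subset codom l.
  by apply/subsetP=> z /(subsetP jA)/codomP[w ->]; rewrite -lj codom_f.
have er r : incl d (incl (cut_decomp jA) r) = incl (cut_decomp lA) r.
  by apply: (@injP _ _ l); rewrite lj !cut_inclE.
have [d3 [es et]] := decomp_assoc er.
apply: (tens_ext1
  (f := fun x => ext_block (F := A :: F ++ G) l (block_catl (A :: F) y x))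
  (g := fun x => mu M d (ext_block (F := A :: F) j x *t ext_block m y))) x.
- by move=> a u v; rewrite !linearP.
- by move=> a u v; rewrite linearP linearPl linearP.
move=> v w; rewrite (ext_block_cons jA) [block_catl _ _ _]tens_mapE (ext_block_cons lA).
rewrite (mu_assoc er es et); congr (mu M _ (_ *t _)).
apply: IHF => [z|z|z].
- by rewrite /= -lj es.
- by rewrite /= -lm et.
have -> : (z \in codom (comp_inj j (sub_inj (~: (j @^-1: A))))) =
    (z \in codom j) && (z \notin A).
  apply/codomP/andP => [[y0 ->]|[/codomP[y0 ->] y0A]].
    by have := valP y0; rewrite !inE; split; first exact: codom_f.
  have yA : y0 \in ~: (j @^-1: A) by rewrite !inE.
  by exists (exist _ y0 yA).
have := Fj z; rewrite /=; case: (boolP (z \in A)) => zA /=.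
  by rewrite (subsetP jA _ zA) add1n => -[->]; rewrite andbF.
by rewrite andbT.
Qed.
End Extension.

Arguments ext_block {k p M} f {I F J} j.

Section ExtensionHom.
Variables (k : fieldType) (p : species k) (M : monoid k) (f : sp_hom p M).

Definition ext_fun (I : finType) : {linear free_obj p I -> M I} :=
  dsum_lift (fun F : comp I => ext_block f (F := F) (id_inj I)).

Lemma ext_fun_pure I (s : seq (block_vec p I)) h :
  ext_fun I (@free_pure k p I s h) = ext_block f (id_inj I) (pure s).
Proof. exact: dsum_lift_in. Qed.

Lemma ext_fun_nat I J (h : bij I J) x :
  ext_fun J (free_map p h x) = sp_map M h (ext_fun I x).
Proof.
apply: (dsum_ext (f := ext_fun J \o free_map p h)
  (g := sp_map M h \o ext_fun I)) x => F v /=.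
rewrite [free_map _ _ _]dsum_lift_in [ext_fun I _]dsum_lift_in /=.
by rewrite [LHS]dsum_lift_in; exact: ext_block_nat.
Qed.

Lemma ext_fun_mu S T I (d : decomp S T I) z :
  ext_fun I (free_mu p d z) = mu M d (tens_map (ext_fun S) (ext_fun T) z).
Proof.
apply: (tens_ext (f := ext_fun I \o free_mu p d)
  (g := mu M d \o tens_map (ext_fun S) (ext_fun T))) z => x y /=.
rewrite tens_mapE.
apply: (free_ext (f := fun x => ext_fun I (free_mu p d (x *t y)))
  (g := fun x => mu M d (ext_fun S x *t ext_fun T y))) x.
- by move=> c u v; rewrite !(linearP, linearPl).
- by move=> c u v; rewrite !(linearP, linearPl).
move=> s hs.
apply: (free_ext (f := fun y => ext_fun I (free_mu p d (_ *t y)))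
  (g := fun y => mu M d (ext_fun S _ *t ext_fun T y))) y.
- by move=> c u v; rewrite !(linearP, linearPr).
- by move=> c u v; rewrite !(linearP, linearPr).
move=> t ht; rewrite (free_mu_pure _ _ (is_comp_vec_cat d hs ht)) !ext_fun_pure.
rewrite -(ext_block_tagged f (id_inj I) (block_cat_pure _ _)) block_catE.
rewrite (ext_block_cat f (j := incl d) (m := incr d) (d := d)) //.
  congr (mu M d (_ *t _)).
    rewrite -(ext_block_tagged f (incl d) (block_map_pure (incl d) s)).
    by rewrite (ext_block_nat f (j := id_inj S) (h := bij_id S)) // sp_map_id.
  rewrite -(ext_block_tagged f (incr d) (block_map_pure (incr d) t)).
  by rewrite (ext_block_nat f (j := id_inj T) (h := bij_id T)) // sp_map_id.
move=> x; rewrite tag_vec_map; case: (boolP (x \in codom (incl d))) => xd.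
  have /codomP[y ->] := xd; rewrite count_seq_im.
  by have := hs; rewrite is_compE => /andP[_ /forallP/(_ y)/eqP].
rewrite count_seq_im0 //; apply: contra xd => /imsetP[y _ ->].
exact: codom_f.
Qed.

Lemma ext_fun_unit c : ext_fun fin0 (free_unit p c) = mon_unit M c.
Proof.
rewrite [LHS]dsum_lift_in ext_block_nil unit_at_fin0 -linearZ /=.
by congr (mon_unit M _); exact: mulr1.
Qed.

Definition ext_hom_sp : sp_hom (free_monoid p) M :=
  @SpHom k (free_monoid p) M ext_fun ext_fun_nat.

Definition ext_hom : mon_hom (free_monoid p) M :=
  @MonHom k (free_monoid p) M ext_hom_sp ext_fun_mu ext_fun_unit.
End ExtensionHom.

(** * Pulling vectors back along an injection *)

Section Pull.
Variables (k : fieldType) (p : species k).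

(** The inverse of [vec_map f] on the vectors supported in the range of [f]. For
the others the map is 0, so that it is linear on every component. *)
Lemma pull_exists (I J : finType) (f : inj J I) (A : {set I}) :
  exists L : {linear p (sub A) -> p (sub (f @^-1: A))},
    A \subset codom f -> forall v,
    vec_map f (Tagged (fun A : {set J} => p (sub A) : Type) (L v)) =
    Tagged (fun A : {set I} => p (sub A) : Type) v.
Proof.
case: (boolP (A \subset codom f)) => fA; last by exists \0.
have [b bE] : exists b : bij (sub A) (sub (f @^-1: A)),
    forall x, f (val (b x)) = val x.
  have fE : f @: (f @^-1: A) = A.
    apply/setP=> x; apply/imsetP/idP => [[y + ->]|xA]; first by rewrite inE.
    by have /codomP[y xy] := subsetP fA _ xA; exists y; rewrite // inE -xy.
  have [c cE] := @sub_bij_exists _ _ f _ _ fE.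
  have [b cK bK] := bijP c.
  by exists (Bij (Bijective bK cK)) => x; rewrite /= -cE bK.
exists (sp_map p b) => _ v; rewrite /vec_map /= -sp_map_comp.
rewrite -[in RHS](sp_map_id v); apply: sp_map_tagged => [|x]; last exact: bE.
apply/setP=> x; apply/imsetP/idP => [[y + ->]|xA]; first by rewrite inE.
by have /codomP[y xy] := subsetP fA _ xA; exists y; rewrite // inE -xy.
Qed.

Definition pull_lin (I J : finType) (f : inj J I) (A : {set I}) :
    {linear p (sub A) -> p (sub (f @^-1: A))} :=
  projT1 (cid (pull_exists f A)).

Definition vec_pull (I J : finType) (f : inj J I) (u : block_vec p I) :
    block_vec p J :=
  Tagged (fun A : {set J} => p (sub A) : Type) (pull_lin f (tag u) (tagged u)).

Lemma vec_pullK (I J : finType) (f : inj J I) (u : block_vec p I) :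
  tag u \subset codom f -> vec_map f (vec_pull f u) = u.
Proof.
case: u => A v fA; rewrite /vec_pull /pull_lin.
by case: (cid _) => L /= -> .
Qed.

Lemma sp_map_inj (I J : finType) (h : bij I J) : injective (sp_map p h).
Proof.
have [h' hK h'K] := bijP h.
apply: (can_inj (g := sp_map p (Bij (Bijective h'K hK)))) => v.
rewrite -sp_map_comp -[RHS]sp_map_id; congr (sp_map p _ _).
exact: bij_ext.
Qed.

Lemma vec_map_inj (I J : finType) (f : inj J I) : injective (vec_map (p := p) f).
Proof.
move=> [A v] [B w] vw.
have AB : A = B.
  apply: (imset_inj (@injP _ _ f)).
  exact: (congr1 (fun u : block_vec p I => tag u) vw).
subst B; congr existT; apply: (@sp_map_inj _ _ (restr f A)).
exact: eq_from_Tagged vw.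
Qed.

Lemma vec_mapK (I J : finType) (f : inj J I) (u : block_vec p J) :
  vec_pull f (vec_map f u) = u.
Proof.
apply: (@vec_map_inj _ _ f); apply: vec_pullK.
by apply/subsetP=> _ /imsetP[x _ ->]; exact: codom_f.
Qed.

Lemma map_vec_pullK (I J : finType) (f : inj J I) (s : seq (block_vec p I)) :
  (forall u, u \in [seq tag u | u <- s] -> u \subset codom f) ->
  map (vec_map f) (map (vec_pull f) s) = s.
Proof.
elim: s => //= u s IHs fs; rewrite vec_pullK ?IHs //; last first.
  by apply: fs; rewrite mem_head.
by move=> v vs; apply: fs; rewrite in_cons vs orbT.
Qed.
End Pull.

(** * Splitting a pure tensor *)

Section SubDecomp.
Variables (I : finType) (X : {set I}).

Lemma sub_decomp_cover :
  [set sub_inj X x | x : sub X] :|: [set sub_inj (~: X) x | x : sub (~: X)] = setT.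
Proof. by rewrite !sub_inj_range setUCr. Qed.

Lemma sub_decomp_disj :
  [disjoint [set sub_inj X x | x : sub X] & [set sub_inj (~: X) x | x : sub (~: X)]].
Proof. by rewrite !sub_inj_range -setI_eq0 setICr. Qed.

Definition sub_decomp : decomp (sub X) (sub (~: X)) I :=
  Decomp sub_decomp_cover sub_decomp_disj.

Lemma codom_sub_inj (A : {set I}) : A \subset X -> A \subset codom (sub_inj X).
Proof.
by move=> /subsetP AX; apply/subsetP=> x /AX xX; apply/codomP; exists (exist _ x xX).
Qed.
End SubDecomp.

Lemma is_comp_split (S T I : finType) (d : decomp S T I) F G :
  is_comp (seq_im (incl d) F ++ seq_im (incr d) G) -> is_comp F /\ is_comp G.
Proof.
rewrite !is_compE mem_cat !set0_seq_im negb_or -andbA.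
case/and3P=> -> -> /forallP FG; split; apply/forallP=> y /=.
  have := FG (incl d y); rewrite count_cat count_seq_im count_seq_im0 ?addn0 //.
  by apply/imsetP=> -[t _ /esym]; exact: decomp_incr_neq_incl.
have := FG (incr d y); rewrite count_cat count_seq_im count_seq_im0 ?add0n //.
by apply/imsetP=> -[t _]; exact: decomp_incr_neq_incl.
Qed.

Lemma free_pure_split (k : fieldType) (p : species k) (I : finType) (X : {set I})
    (s t : seq (block_vec p I)) (h : is_comp (map tag (s ++ t))) :
  (forall A, A \in map tag s -> A \subset X) ->
  (forall A, A \in map tag t -> A \subset ~: X) ->
  exists hs ht, free_pure h = free_mu p (sub_decomp X)
    (@free_pure k p _ (map (vec_pull (sub_inj X)) s) hs *t
     @free_pure k p _ (map (vec_pull (sub_inj (~: X))) t) ht).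
Proof.
move=> sX tX.
have sK : map (vec_map (sub_inj X)) (map (vec_pull (sub_inj X)) s) = s.
  by apply: map_vec_pullK => A /sX; exact: codom_sub_inj.
have tK : map (vec_map (sub_inj (~: X))) (map (vec_pull (sub_inj (~: X))) t) = t.
  by apply: map_vec_pullK => A /tX; exact: codom_sub_inj.
have [hs ht] : is_comp (map tag (map (vec_pull (sub_inj X)) s)) /\
               is_comp (map tag (map (vec_pull (sub_inj (~: X))) t)).
  apply: (@is_comp_split _ _ _ (sub_decomp X)).
  by rewrite -!tag_vec_map sK tK -map_cat.
exists hs, ht; rewrite (free_mu_pure _ _ (is_comp_vec_cat _ hs ht)).
by apply: free_pure_eq; rewrite /= sK tK.
Qed.

(** * Generators of the free monoid *)

Lemma full_bij_bijective (I : finType) :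
  bijective (fun x : I => exist _ x (in_setT x) : sub [set: I]).
Proof. by exists val => // x; exact: val_inj. Qed.

Definition full_bij (I : finType) : bij I (sub [set: I]) :=
  Bij (full_bij_bijective I).

Definition img_bij (S I : finType) (f : inj S I) : bij S (sub (f @: [set: S])) :=
  comp_bij (restr f [set: S]) (full_bij S).

Section Generators.
Variables (k : fieldType) (p : species k).

(** [P] is a function on all lists of vectors; linearity in each entry makes it
a linear map on each [p(F)], see [block_lift]. *)
Definition multilinear (I : finType) (V : lmodType k)
    (P : seq (block_vec p I) -> V) :=
  forall s A t, linear (fun v : p (sub A) => P (s ++ bvec p v :: t)).

(** Being total, [free_of] can be fed lists whose blocks are only known to form a
composition after rewriting. *)
Definition free_of (I : finType) (s : seq (block_vec p I)) : free_obj p I :=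
  if is_comp (map tag s) =P true is ReflectT h then free_pure h else 0.

Lemma free_ofE I (s : seq (block_vec p I)) h : free_of s = @free_pure k p I s h.
Proof.
by rewrite /free_of; case: eqP => [h'|]; [exact: free_pure_eq | rewrite h].
Qed.

Lemma free_of0 I (s : seq (block_vec p I)) :
  ~~ is_comp (map tag s) -> free_of s = 0.
Proof. by move=> /negP h; rewrite /free_of; case: eqP. Qed.

(** The type of a pure tensor changes with the list of its factors. Writing it
as a value of the bilinear map [block_cat] brings all of them into one space. *)
Lemma free_of_multilinear I : multilinear (@free_of I).
Proof.
move=> s A t a v w; have E : forall v : p (sub A),
    map tag (s ++ bvec p v :: t) = map tag s ++ A :: map tag t.
  by move=> u; rewrite map_cat.
case: (boolP (is_comp (map tag s ++ A :: map tag t))) => h; last first.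
  by rewrite !free_of0 ?E // scaler0 addr0.
have {}E (u : p (sub A)) : free_of (s ++ bvec p u :: t) =
    free_in p (Comp h)
      (block_cat (pure s *t (u *t pure t : block_tens p (A :: map tag t)))).
  have h' := h; rewrite -(E u) in h'; rewrite (free_ofE h').
  by apply: free_in_tagged; rewrite -(block_cat_pure s (bvec p u :: t)).
by rewrite !E linearPl linearPr linearP linearP.
Qed.

(** The inclusion of [p[I]] as the summand of the one-block composition. *)
Definition gen_fun I (v : p I) : free_obj p I :=
  free_of [:: bvec p (sp_map p (full_bij I) v)].

Lemma gen_is_linear I : linear (@gen_fun I).
Proof.
by move=> a v w; rewrite /gen_fun linearP (@free_of_multilinear I [::]).
Qed.

Definition gen I : {linear p I -> free_obj p I} := pack_linear (@gen_is_linear I).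

Lemma genE I v : gen I v = free_of [:: bvec p (sp_map p (full_bij I) v)].
Proof. by rewrite /gen pack_linearE. Qed.

Lemma is_comp_full (I : finType) : is_comp [:: [set: I]] = (0 < #|I|)%N.
Proof.
rewrite is_compE inE eq_sym -card_gt0 cardsT; case: (0 < _)%N => //=.
by apply/forallP=> x; rewrite /= inE.
Qed.

Lemma vec_map_full (S I : finType) (f : inj S I) v :
  vec_map f (bvec p (sp_map p (full_bij S) v)) = bvec p (sp_map p (img_bij f) v).
Proof. by rewrite /vec_map /= -sp_map_comp. Qed.

Lemma mu_gen_pure (S T I : finType) (d : decomp S T I) (v : p S) t ht :
  (0 < #|S|)%N ->
  free_mu p d (gen S v *t @free_pure k p T t ht) =
  free_of (bvec p (sp_map p (img_bij (incl d)) v) :: map (vec_map (incr d)) t).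
Proof.
move=> S0; have hs : is_comp (map tag [:: bvec p (sp_map p (full_bij S) v)]).
  by rewrite /= is_comp_full.
rewrite genE (free_ofE hs) (free_mu_pure _ _ (is_comp_vec_cat d hs ht)).
by rewrite -free_ofE /= vec_map_full.
Qed.

Lemma free_pure_full (I : finType) (w : block_vec p I) h :
  tag w = setT -> exists v, @free_pure k p I [:: w] h = gen I v.
Proof.
case: w h => A w /= h AT; subst A.
have [g gK Kg] := bijP (full_bij I).
exists (sp_map p (Bij (Bijective Kg gK)) w).
rewrite genE -free_ofE; congr (free_of [:: bvec p _]).
rewrite -sp_map_comp -[LHS]sp_map_id; congr (sp_map p _ _).
by apply: bij_ext => x; exact: esym (Kg x).
Qed.

(** [T(p)] is generated by [p]: a pure tensor with blocks [A], [A_2], ..., [A_k]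
is the product of a generator on [A] and a pure tensor on the complement. *)
Lemma free_gen_ind (P : forall I, free_obj p I -> Prop) :
    (forall I, P I 0) ->
    (forall I a x y, P I x -> P I y -> P I (a *: x + y)) ->
    (forall I h, P I (@free_pure k p I [::] h)) ->
    (forall S T I (d : decomp S T I) v y, (0 < #|S|)%N -> P T y ->
       P I (free_mu p d (gen S v *t y))) ->
  forall I x, P I x.
Proof.
move=> P0 PD Pnil Pcons I x; elim/free_ind: x; [exact: P0 | exact: PD |].
move=> s; have [n] := ubnP (size s); elim: n => // n IHn in I s *.
case: s => [|u s] /= sn h; first exact: Pnil.
have disj A : A \in map tag s -> [disjoint tag u & A].
  by case/and3P: (h) => _ /= /andP[/allP us _] _ /us.
have [] := @free_pure_split k p I (tag u) [:: u] s h.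
- by move=> A; rewrite inE => /eqP ->.
- by move=> A /disj; rewrite disjoint_sym disjoints_subset.
move=> hs [ht ->].
have [|v ->] := free_pure_full hs.
  by apply/setP=> x; rewrite !inE; exact: (valP x).
apply: Pcons; last by apply: IHn; rewrite size_map.
rewrite card_sig (eq_card (B := tag u)) // card_gt0.
by case/andP: (h); rewrite inE negb_or eq_sym => /andP[].
Qed.
End Generators.

(** * The universal property of the free monoid *)

Section MonHomComp.
Variables (k : fieldType) (L M N : monoid k) (g : mon_hom M N) (f : mon_hom L M).

Lemma mon_hom_comp_nat I J (h : bij I J) x :
  (g J \o f J) (sp_map L h x) = sp_map N h ((g I \o f I) x).
Proof. by rewrite /= !sp_hom_nat. Qed.

Definition mon_hom_comp_sp : sp_hom L N :=
  @SpHom k L N (fun I => g I \o f I) mon_hom_comp_nat.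

Lemma mon_hom_comp_mu S T I (d : decomp S T I) z :
  mon_hom_comp_sp I (mu L d z) =
  mu N d (tens_map (mon_hom_comp_sp S) (mon_hom_comp_sp T) z).
Proof.
apply: (tens_ext (f := mon_hom_comp_sp I \o mu L d)
  (g := mu N d \o tens_map (mon_hom_comp_sp S) (mon_hom_comp_sp T))) z => x y.
by rewrite /= !mon_hom_mu !tens_mapE.
Qed.

Lemma mon_hom_comp_unit c : mon_hom_comp_sp fin0 (mon_unit L c) = mon_unit N c.
Proof. by rewrite /= !mon_hom_unit. Qed.

Definition mon_hom_comp : mon_hom L N := MonHom mon_hom_comp_mu mon_hom_comp_unit.
End MonHomComp.

Section Freeness.
Variables (k : fieldType) (M : monoid k).

(** Positivity of [p] is what makes this true on the empty set, where [gen] is 0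
because the empty set has no one-block composition. *)
Lemma ext_gen (p : pos_species k) (f : sp_hom p M) I v :
  ext_hom f I (gen p I v) = f I v.
Proof.
have [I0|I_gt0] := posnP #|I|.
  by rewrite (pos_spP I0 v) !linear0.
have hI : is_comp (map tag [:: bvec p (sp_map p (full_bij I) v)]).
  by rewrite /= is_comp_full.
rewrite genE (free_ofE hI) [LHS]ext_fun_pure.
have jA : [set: I] \subset codom (id_inj I).
  by apply/subsetP=> x _; exact: (codom_f (id_inj I) x).
rewrite (ext_block_cons f jA) ext_block_nil scale1r.
have vbij : bijective (incl (cut_decomp jA)).
  exists (full_bij I) => x; last exact: (cut_inclE jA (full_bij I x)).
  by apply: val_inj; exact: (cut_inclE jA x).
rewrite (mu_unit_at_r (h := Bij vbij)) //.
  rewrite /= sp_hom_nat -sp_map_comp -[RHS]sp_map_id; congr (sp_map M _ _).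
  by apply: bij_ext => x; exact: (cut_inclE jA (full_bij I x)).
by rewrite card_sig eq_card0 // => x; rewrite !inE.
Qed.

Lemma free_pure_nil_map (p : species k) (I : finType) h (I0 : #|I| = 0%N) :
  @free_pure k p I [::] h = free_map p (empty_bij I0) (free_unit p 1).
Proof.
rewrite free_unitE; apply/esym.
exact: (@free_map_pure k p _ _ (empty_bij I0) [::]).
Qed.

Lemma is_comp_nil_card (I : finType) : is_comp ([::] : seq {set I}) -> #|I| = 0%N.
Proof. by rewrite is_compE => /forallP h; apply: eq_card0 => x; have := h x. Qed.

Lemma free_hom_unique (p : species k) (f g : mon_hom (free_monoid p) M) :
  (forall I v, f I (gen p I v) = g I (gen p I v)) -> forall I x, f I x = g I x.
Proof.
move=> fg; apply: free_gen_ind => [I|I a x y fgx fgy|I h|S T I d v y _ fgy].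
- by rewrite !linear0.
- by rewrite !linearP fgx fgy.
- rewrite (free_pure_nil_map _ (is_comp_nil_card h)).
  rewrite -[free_map p]/(sp_map (free_monoid p)).
  by rewrite !sp_hom_nat -[free_unit p]/(mon_unit (free_monoid p)) !mon_hom_unit.
rewrite -[free_mu p d]/(mu (free_monoid p) d) !mon_hom_mu !tens_mapE.
by rewrite fg fgy.
Qed.
End Freeness.

Lemma free_hom_gen (k : fieldType) (p q : species k) (a : sp_hom p q) I v :
  free_hom a I (gen p I v) = gen q I (a I v).
Proof.
rewrite !genE.
have [I0|I_gt0] := posnP #|I|.
  by rewrite !free_of0 ?linear0 //= is_comp_full I0.
have hI (r : species k) w : is_comp (map tag [:: bvec r (w : r (sub [set: I]))]).
  by rewrite /= is_comp_full.
rewrite (free_ofE (hI _ _)) (free_ofE (hI _ _)).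
rewrite [LHS](@free_hom_pure k p q a I _ _ (is_comp_vec_hom a (hI _ _))).
by apply: free_pure_eq; rewrite /= /vec_hom /= sp_hom_nat.
Qed.

(** * The comparison morphism *)

Section Comparison.
Variables (k : fieldType) (p q : species k).

(** On the summand of (F, G) this is the inclusion of [p(F) (x) q(G)] in the
tensor product of the two direct sums. *)
Definition star_gen_fun (I : finType) :
    {linear star p q I -> hadamard (free_monoid p) (free_monoid q) I} :=
  dsum_lift (fun FG : star_idx I =>
    tens_map (free_in p (val FG).1) (free_in q (val FG).2)).

Lemma star_gen_pure I s t hs ht h :
  star_gen_fun I (@star_pure k p q I s t hs ht h) =
  free_pure hs *t free_pure ht.
Proof. by rewrite [LHS]dsum_lift_in tens_mapE. Qed.

Lemma star_gen_nat I J (f : bij I J) x :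
  star_gen_fun J (star_map p q f x) =
  had_map (free_monoid p) (free_monoid q) f (star_gen_fun I x).
Proof.
apply: (star_ext (f := star_gen_fun J \o star_map p q f)
  (g := had_map (free_monoid p) (free_monoid q) f \o star_gen_fun I)) x.
move=> s t hs ht h /=; rewrite (star_map_pure _ (star_pred_vec_map f h)).
rewrite !star_gen_pure [RHS]tens_mapE.
by congr (_ *t _); apply/esym; exact: free_map_pure.
Qed.

Definition star_gen :
    sp_hom (star p q) (hadamard (free_monoid p) (free_monoid q)) :=
  @SpHom k (star p q) (hadamard (free_monoid p) (free_monoid q))
    star_gen_fun star_gen_nat.

Definition comparison :
    mon_hom (free_monoid (star p q)) (hadamard (free_monoid p) (free_monoid q)) :=
  ext_hom star_gen.

Lemma comparison_gen_pure I s t hs ht h :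
  comparison I (gen (star p q) I (@star_pure k p q I s t hs ht h)) =
  free_pure hs *t free_pure ht.
Proof. by rewrite ext_gen [LHS]star_gen_pure. Qed.

Lemma comparison_nil I h h' h'' :
  comparison I (@free_pure k (star p q) I [::] h) =
  @free_pure k p I [::] h' *t @free_pure k q I [::] h''.
Proof.
have I0 := is_comp_nil_card h; rewrite !(free_pure_nil_map _ I0).
rewrite -[free_map (star p q)]/(sp_map (free_monoid (star p q))).
rewrite sp_hom_nat -[free_unit (star p q)]/(mon_unit (free_monoid (star p q))).
by rewrite mon_hom_unit [mon_unit _ _]pack_linearE [LHS]tens_mapE.
Qed.
End Comparison.

Lemma comparison_natural (k : fieldType) (p p' q q' : species k)
    (a : sp_hom p p') (b : sp_hom q q') (I : finType) x :
  comparison p' q' I (free_hom (star_hom a b) I x) =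
  had_hom (free_hom a) (free_hom b) I (comparison p q I x).
Proof.
pose f := mon_hom_comp (comparison p' q') (free_hom (star_hom a b)).
pose g := mon_hom_comp (had_hom (free_hom a) (free_hom b)) (comparison p q).
apply: (free_hom_unique (f := f) (g := g)) => {x} J v.
rewrite /f /g /= free_hom_gen [LHS](ext_gen (p := star p' q') (star_gen p' q')).
rewrite [X in _ = _ X](ext_gen (p := star p q) (star_gen p q)).
apply: (star_ext (f := star_gen_fun p' q' J \o star_hom_fun a b J)
  (g := had_hom_fun (free_hom a) (free_hom b) J \o star_gen_fun p q J)) v.
move=> s t hs ht h /=.
rewrite (star_hom_pure _ (star_pred_vec_hom a b h)) !star_gen_pure [RHS]tens_mapE.
by congr (_ *t _); apply/esym; exact: free_hom_pure.
Qed.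

(** * Flags *)

Section Flags.
Variable I : finType.
Implicit Types (F G : seq {set I}) (X A : {set I}).

Lemma flagP F X :
  reflect (exists i, X = \bigcup_(A <- take i F) A) (X \in flag F).
Proof.
apply: (iffP imsetP) => [[i _ ->]|[i ->]]; first by exists i.
have [iF|Fi] := leqP i (size F).
  by exists (Ordinal (iF : i < (size F).+1)%N).
by exists ord_max => //=; rewrite take_size take_oversize // ltnW.
Qed.

Lemma flag_set0 F : set0 \in flag F.
Proof. by apply/flagP; exists 0%N; rewrite take0 big_nil. Qed.

Lemma flag_full F : \bigcup_(A <- F) A \in flag F.
Proof. by apply/flagP; exists (size F); rewrite take_size. Qed.

Lemma flag_cons A F : flag (A :: F) = set0 |: [set A :|: X | X in flag F].
Proof.
apply/setP=> X; rewrite !inE; apply/flagP/predU1P.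
  case=> -[|i] -> /=; first by left; rewrite big_nil.
  right; apply/imsetP; exists (\bigcup_(A <- take i F) A); last exact: big_cons.
  by apply/flagP; exists i.
case=> [->|/imsetP[_ /flagP[i ->] ->]]; first by exists 0%N; rewrite big_nil.
by exists i.+1; rewrite /= big_cons.
Qed.

Lemma flag_full1 : flag [:: [set: I]] = [set set0; setT].
Proof.
apply/setP=> X; rewrite flag_cons !inE; congr (_ || _).
apply/imsetP/eqP => [[Y _ ->]|->]; first by rewrite setTU.
by exists set0; rewrite ?setTU // flag_set0.
Qed.

Lemma comp_blocks_neq0 F : is_comp F -> set0 \notin F.
Proof. by case/and3P. Qed.

Lemma comp_cover F :
  is_comp F -> \bigcup_(A <- F) A = setT.
Proof. by case/and3P=> _ _ /eqP. Qed.

Lemma comp_flag_full F : is_comp F -> setT \in flag F.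
Proof. by case/and3P=> _ _ /eqP <-; exact: flag_full. Qed.

Lemma bigcup_seq_sup F A : A \in F -> A \subset \bigcup_(B <- F) B.
Proof.
by move=> AF; apply/subsetP=> x xA; rewrite in_bigcup_seq; apply/hasP; exists A.
Qed.

Lemma comp_drop_disjoint F i A :
  is_comp F -> A \in drop i F -> A \subset ~: \bigcup_(B <- take i F) B.
Proof.
case/and3P=> _ + _ AF; rewrite -{1}[F](cat_take_drop i) pairwise_cat.
case/and3P=> /allrelP FF _ _; rewrite -disjoints_subset.
rewrite disjoint_subset; apply/subsetP=> x xA; rewrite inE in_bigcup_seq.
apply/hasPn=> B BF; have := FF _ _ BF AF; rewrite disjoint_sym => BA.
by rewrite (disjointFr BA xA).
Qed.
End Flags.

Lemma flag_subset (I : finType) (F : seq {set I}) X :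
  X \in flag F -> X \subset \bigcup_(A <- F) A.
Proof.
case/flagP=> i ->; rewrite -{2}[F](cat_take_drop i) big_cat /=.
exact: subsetUl.
Qed.

Lemma flag_cat (I : finType) (F G : seq {set I}) :
  flag (F ++ G) = flag F :|: [set (\bigcup_(A <- F) A) :|: X | X in flag G].
Proof.
elim: F => [|A F IHF].
  have -> : flag [::] = [set set0 : {set I}].
    apply/setP=> X; rewrite inE; apply/flagP/eqP => [[i ->]|->].
      by rewrite big_nil.
    by exists 0%N; rewrite big_nil.
  rewrite big_nil (eq_imset _ (@set0U _)) imset_id.
  by apply/esym/setUidPr; rewrite sub1set flag_set0.
rewrite /= flag_cons IHF big_cons imsetU setUA -flag_cons -imset_comp.
by congr (_ :|: _); apply: eq_imset => X /=; rewrite setUA.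
Qed.

Lemma setU_inj_disjoint (I : finType) (U X Y : {set I}) :
  X \subset ~: U -> Y \subset ~: U -> U :|: X = U :|: Y -> X = Y.
Proof.
move=> XU YU UXY; have E (Z : {set I}) : Z \subset ~: U -> Z = (U :|: Z) :\: U.
  by move=> ZU; rewrite setDUl setDv set0U setDE; apply/esym/setIidPl.
by rewrite (E X XU) (E Y YU) UXY.
Qed.

(** The first block of a composition is the least nonempty member of its flag,
and the flag of the other blocks is obtained by removing it from the nonempty
members. *)
Lemma flag_inj (I : finType) (F G : seq {set I}) :
  set0 \notin F -> set0 \notin G ->
  pairwise (fun A B : {set I} => [disjoint A & B]) F ->
  pairwise (fun A B : {set I} => [disjoint A & B]) G ->
  flag F = flag G -> F = G.
Proof.
have first (A B : {set I}) F' G' : A != set0 -> flag (A :: F') = flag (B :: G') ->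
    B \subset A.
  move=> A0 FG; have : A \in flag (B :: G').
    rewrite -FG flag_cons !inE; apply/orP; right; apply/imsetP.
    by exists set0; rewrite ?setU0 // flag_set0.
  rewrite flag_cons !inE (negPf A0) => /imsetP[X _ ->]; exact: subsetUl.
have disj (A : {set I}) F' X : all (fun B : {set I} => [disjoint A & B]) F' ->
    X \in flag F' -> X \subset ~: A.
  move=> /allP AF /flag_subset XF; apply: subset_trans XF _.
  apply/subsetP=> x; rewrite in_bigcup_seq inE => /hasP[B /AF AB xB].
  by rewrite (disjointFl AB xB).
have notnil (A : {set I}) F' : A != set0 -> flag (A :: F') <> flag [::] :> {set {set I}}.
  move=> A0 /(congr1 (fun S : {set {set I}} => A \in S)).
  have -> : A \in flag (A :: F').
    rewrite flag_cons !inE; apply/orP; right; apply/imsetP.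
    by exists set0; rewrite ?setU0 // flag_set0.
  move/esym/flagP=> [i]; rewrite big_nil => AE.
  by rewrite AE eqxx in A0.
elim: F G => [|A F IHF] [|B G] //.
- by rewrite inE negb_or eq_sym => _ /andP[B0 _] _ _ /esym /notnil -/(_ B0).
- by rewrite inE negb_or eq_sym => /andP[A0 _] _ _ _ /notnil -/(_ A0).
rewrite !inE !negb_or ![set0 == _]eq_sym => /andP[A0 F0] /andP[B0 G0].
move=> /= /andP[AF pF] /andP[BG pG] FG.
have AB : A = B.
  apply/eqP; rewrite eqEsubset (first _ _ _ _ A0 FG).
  by rewrite (first _ _ _ _ B0 (esym FG)).
subst B; congr (_ :: _); apply: IHF => //.
have sub F' G' : all (fun B : {set I} => [disjoint A & B]) F' ->
    all (fun B : {set I} => [disjoint A & B]) G' ->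
    flag (A :: F') = flag (A :: G') -> flag F' \subset flag G'.
  move=> AF' AG' E; apply/subsetP=> X XF.
  have : A :|: X \in flag (A :: G').
    by rewrite -E flag_cons !inE; apply/orP; right; apply: imset_f.
  rewrite flag_cons !inE setU_eq0 (negPf A0) /= => /imsetP[Y YG].
  by move/(setU_inj_disjoint (disj _ _ _ AF' XF) (disj _ _ _ AG' YG)) => ->.
by apply/eqP; rewrite eqEsubset !sub.
Qed.

(** Every member of the two flags is comparable with [U]. Those below [U] come
from [F1] and [G1], whose common members are the empty set and [U]; those above
[U] are unions of [U] with members of the flags of [F2] and [G2]. *)
Lemma is_meet_cat (I : finType) (U : {set I}) (F1 G1 F2 G2 H2 : seq {set I}) :
  \bigcup_(A <- F1) A = U -> \bigcup_(A <- G1) A = U ->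
  (forall A, A \in F2 -> A \subset ~: U) -> (forall A, A \in G2 -> A \subset ~: U) ->
  is_meet F1 G1 [:: U] -> is_meet F2 G2 H2 ->
  is_meet (F1 ++ F2) (G1 ++ G2) (U :: H2).
Proof.
move=> FU GU F2U G2U /eqP M1 /eqP M2; apply/eqP.
rewrite -cat1s !flag_cat M1 FU GU big_cons big_nil setU0 M2.
have sub (F : seq {set I}) X : (forall A, A \in F -> A \subset ~: U) ->
    X \in flag F -> X \subset ~: U.
  move=> FU' /flag_subset XF; apply: subset_trans XF _.
  by apply/subsetP=> x; rewrite in_bigcup_seq => /hasP[A /FU'/subsetP]; exact.
have top (F : seq {set I}) (G : seq {set I}) X : \bigcup_(A <- F) A = U ->
    X \in flag F -> X \in [set U :|: Y | Y in flag G] -> X = U.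
  move=> FU' /flag_subset; rewrite FU' => XU /imsetP[Y _ XE].
  by apply/eqP; rewrite eqEsubset XU XE subsetUl.
have U1 : U \in flag F1 :&: flag G1 by rewrite inE -{1}FU -GU !flag_full.
have bot (G : seq {set I}) : U \in [set U :|: Y | Y in flag G].
  by apply/imsetP; exists set0; rewrite ?setU0 // flag_set0.
apply/setP=> X; rewrite !inE; apply/orP/andP.
  case=> [/andP[-> ->] //|/imsetP[Y /setIP[YF YG] ->]].
  by split; apply/orP; right; apply: imset_f.
case=> /orP[XF|XF] /orP[XG|XG].
- by left; rewrite XF.
- by left; rewrite (top _ _ _ FU XF XG); have := U1; rewrite inE.
- by left; rewrite (top _ _ _ GU XG XF); have := U1; rewrite inE.
right; have /imsetP[Y YF XY] := XF; have /imsetP[Z ZG XZ] := XG.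
have YZ : Y = Z.
  apply: (setU_inj_disjoint (sub _ _ F2U YF) (sub _ _ G2U ZG)).
  by rewrite -XY.
by apply/imsetP; exists Y => //; rewrite inE YF YZ.
Qed.

Lemma bigcup_seq_im (I J : finType) (f : I -> J) (F : seq {set I}) :
  \bigcup_(A <- seq_im f F) A = f @: (\bigcup_(A <- F) A).
Proof.
elim: F => [|A F IHF]; first by rewrite !big_nil imset0.
by rewrite /= !big_cons IHF imsetU.
Qed.

(** * Surjectivity *)

Section Surjectivity.
Variables (k : fieldType) (p q : species k).
Local Notation phi := (comparison p q).

Lemma empty_comp_nil (r : species k) (I : finType) (s : seq (block_vec r I)) :
  #|I| = 0%N -> is_comp (map tag s) -> s = [::].
Proof.
case: s => //= u s I0; rewrite is_compE inE negb_or -andbA => /and3P[u0 _ _].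
by case/eqP: u0; apply/setP=> x; have := fintype0 x; rewrite I0.
Qed.

(** A common member [X] of the two flags other than the empty set and [I] writes
both tensors as products over [X] and its complement. *)
Lemma comparison_pure_surj I s t hs ht :
  exists x, phi I x = @free_pure k p I s hs *t @free_pure k q I t ht.
Proof.
have [n] := ubnP #|I|; elim: n => // n IHn in I s t hs ht *; rewrite ltnS => In.
have [I0|I_gt0] := posnP #|I|.
  have s0 := empty_comp_nil I0 hs; have t0 := empty_comp_nil I0 ht; subst s t.
  by exists (@free_pure k (star p q) I [::] hs); exact: comparison_nil.
case: (boolP (star_pred (Comp hs, Comp ht))) => [st|].
  by exists (gen (star p q) I (star_pure st)); exact: comparison_gen_pure.
rewrite /star_pred I_gt0 /is_meet flag_full1 /= eqEsubset => nst.
have {nst} [X /andP[/flagP[i Xi] /flagP[j Xj]] /andP[X0 XT]] : exists2 X,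
    (X \in flag (map tag s)) && (X \in flag (map tag t)) &
    (X != set0) && (X != setT).
  move: nst; rewrite subUset !sub1set !inE !flag_set0 !comp_flag_full //=.
  case/subsetPn=> X; rewrite inE => XX; rewrite !inE negb_or => X0.
  by exists X.
have cut (r : species k) (u : seq (block_vec r I)) hu m :
    X = \bigcup_(A <- take m (map tag u)) A ->
    exists hu1 hu2, @free_pure k r I u hu = free_mu r (sub_decomp X)
      (@free_pure k r _ (map (vec_pull (sub_inj X)) (take m u)) hu1 *t
       @free_pure k r _ (map (vec_pull (sub_inj (~: X))) (drop m u)) hu2).
  move=> Xm; have hu' := hu; rewrite -{1}[u](cat_take_drop m) in hu'.
  have [A Am|A Am|h1 [h2 E]] := free_pure_split (X := X) hu'.
  - by rewrite Xm -map_take; exact: bigcup_seq_sup.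
  - by rewrite Xm; apply: comp_drop_disjoint hu _; rewrite -map_drop.
  by exists h1, h2; rewrite -E; apply: free_pure_eq; rewrite cat_take_drop.
have [hs1 [hs2 ->]] := cut _ _ hs _ Xi; have [ht1 [ht2 ->]] := cut _ _ ht _ Xj.
have [|x1 x1E] := IHn (sub X) _ _ hs1 ht1.
  rewrite card_sig (eq_card (B := X)) //; apply: leq_trans In.
  by rewrite -cardsT proper_card // properT.
have [|x2 x2E] := IHn (sub (~: X)) _ _ hs2 ht2.
  rewrite card_sig (eq_card (B := ~: X)) //; apply: leq_trans In.
  by rewrite -cardsT proper_card // properT -setC0 (inj_eq (@setC_inj I)).
exists (mu (free_monoid (star p q)) (sub_decomp X) (x1 *t x2)).
rewrite (mon_hom_mu phi) tens_mapE x1E x2E.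
exact: (@had_muE k (free_monoid p) (free_monoid q)).
Qed.

Lemma comparison_surj I y : exists x, phi I x = y.
Proof.
have lin a x1 x2 : phi I (a *: x1 + x2) = a *: phi I x1 + phi I x2.
  exact: linearP.
elim/tens_ind: y => [|v w y [x xy]]; first by exists 0; rewrite linear0.
suff [x' x'E] : exists x, phi I x = v *t w.
  by exists (x' + x); rewrite linearD x'E xy.
elim/free_ind: v => [|a v v' [x1 x1E] [x2 x2E]|s hs].
- by exists 0; rewrite linear0 linear0l.
- by exists (a *: x1 + x2); rewrite lin x1E x2E linearPl.
elim/free_ind: w => [|a w w' [x1 x1E] [x2 x2E]|t ht].
- by exists 0; rewrite linear0 linear0r.
- by exists (a *: x1 + x2); rewrite lin x1E x2E linearPr.
exact: comparison_pure_surj.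
Qed.
End Surjectivity.

(** * Linear maps defined on pure tensors *)

Lemma comb_is_linear (k : fieldType) (U V : lmodType k) (a : k)
    (f g : {linear U -> V}) : linear (fun x => a *: f x + g x).
Proof.
move=> b x y; rewrite (linearP f) (linearP g) !scalerDr !scalerA [b * a]mulrC.
by rewrite addrACA.
Qed.

Section MultilinearLift.
Variables (k : fieldType) (p : species k) (I : finType).

(** The universal property of [p(F)] as an iterated tensor product. *)
Lemma block_lift (V : lmodType k) (P : seq (block_vec p I) -> V) F :
  multilinear P ->
  exists f : {linear block_tens p F -> V},
    forall s (e : map tag s = F), f (ecast F (block_tens p F) e (pure s)) = P s.
Proof.
elim: F P => [|A F IHF] P mP.
  exists (pack_linear (scale_is_linear (P [::]))) => -[|//] e.
  by rewrite eq_axiomK /= pack_linearE scale1r.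
have mPv (v : p (sub A)) : multilinear (fun s => P (bvec p v :: s)).
  by move=> s B t; exact: (mP (bvec p v :: s)).
have [f fE] := choice (fun v => IHF _ (mPv v)).
have fbil : bilinear_for *:%R *:%R (fun v x => f v x).
  split=> [x a v w|v a x y] /=; last exact: linearP.
  elim/block_ind: x => [|b x y IHx IHy|s e]; first by rewrite !linear0 addr0.
    rewrite !linearP IHx IHy !scalerDr !scalerA [b * a]mulrC.
    by rewrite addrACA.
  by rewrite !fE (mP [::]).
exists (tens_lift (pack_bilinear fbil)) => -[//|[B v] s] /= e.
have [e1 e2] := e; subst B; subst F.
by rewrite eq_axiomK /= tens_liftE pack_bilinearE (fE v s erefl).
Qed.

Lemma free_lift (V : lmodType k) (P : seq (block_vec p I) -> V) :
  multilinear P ->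
  exists f : {linear free_obj p I -> V}, forall s h, f (@free_pure k p I s h) = P s.
Proof.
move=> mP; pose f F := projT1 (cid (block_lift F mP)).
exists (dsum_lift (fun F : comp I => f F)) => s h.
rewrite dsum_lift_in; exact: (projT2 (cid (block_lift (map tag s) mP)) s erefl).
Qed.
End MultilinearLift.

Lemma free_lift2 (k : fieldType) (p q : species k) (I : finType) (V : lmodType k)
    (P : seq (block_vec p I) -> seq (block_vec q I) -> V) :
  (forall t, multilinear (P^~ t)) -> (forall s, multilinear (P s)) ->
  exists f : {linear free_obj p I \ox free_obj q I -> V},
    forall s hs t ht, f (@free_pure k p I s hs *t @free_pure k q I t ht) = P s t.
Proof.
move=> mPl mPr; have [g gE] := choice (fun s => free_lift (mPr s)).
have mg y : multilinear (fun s => g s y).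
  move=> s A t a v w /=.
  apply: (free_ext (f := g (s ++ bvec p (a *: v + w) :: t))
    (g := fun y => a *: g (s ++ bvec p v :: t) y + g (s ++ bvec p w :: t) y)).
  - by move=> b x z; rewrite linearP.
  - exact: comb_is_linear.
  by move=> u hu; rewrite !gE (mPl u).
have [f fE] := choice (fun y => free_lift (mg y)).
have fbil : bilinear_for *:%R *:%R (fun x y => f y x).
  split=> [y a v w|x a y z] /=; first exact: linearP.
  apply: (free_ext (f := f (a *: y + z)) (g := fun x => a *: f y x + f z x)).
  - by move=> b v w; rewrite linearP.
  - exact: comb_is_linear.
  by move=> u hu; rewrite !fE linearP.
exists (tens_lift (pack_bilinear fbil)) => s hs t ht.
by rewrite tens_liftE pack_bilinearE fE gE.
Qed.

(** * Pure tensors of the star product *)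

Section StarOf.
Variables (k : fieldType) (p q : species k).

Definition star_ok (I : finType) (F G : seq {set I}) : bool :=
  [&& is_comp F, is_comp G, (0 < #|I|)%N & is_meet F G [:: [set: I]]].

Lemma star_okP I (s : seq (block_vec p I)) (t : seq (block_vec q I)) :
  star_ok (map tag s) (map tag t) ->
  {hst : is_comp (map tag s) * is_comp (map tag t)
       | star_pred (Comp hst.1, Comp hst.2)}.
Proof.
by move=> st; case/and4P: (st) => hs ht I0 FG; exists (hs, ht); apply/andP.
Qed.

(** Like [free_of], a total version of [star_pure]: 0 when the pair of lists does
not index a summand. *)
Definition star_of (I : finType) (s : seq (block_vec p I))
    (t : seq (block_vec q I)) : star_obj p q I :=
  if star_ok (map tag s) (map tag t) =P true is ReflectT st
  then star_pure (projT2 (star_okP st)) else 0.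

Lemma star_ofE I s t hs ht h :
  star_of s t = @star_pure k p q I s t hs ht h.
Proof.
rewrite /star_of; case: eqP => [st|[]]; first exact: star_pure_eq.
by case/andP: h => I0 FG; apply/and4P.
Qed.

Lemma star_of0 I (s : seq (block_vec p I)) (t : seq (block_vec q I)) :
  ~~ star_ok (map tag s) (map tag t) -> star_of s t = 0.
Proof. by move=> /negP st; rewrite /star_of; case: eqP. Qed.

Lemma tag_insert (r : species k) (I : finType) (s t : seq (block_vec r I)) A
    (v : r (sub A)) :
  map tag (s ++ bvec r v :: t) = map tag s ++ A :: map tag t.
Proof. by rewrite map_cat. Qed.

Lemma star_of_multilinear_l I t : multilinear (fun s => @star_of I s t).
Proof.
move=> s1 A s2 a v w.
case: (boolP (star_ok (map tag s1 ++ A :: map tag s2) (map tag t))) => st; last first.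
  by rewrite !star_of0 ?tag_insert // scaler0 addr0.
case/and4P: (st) => hs ht I0 FG.
have h : star_pred (Comp hs, Comp ht) by apply/andP.
have E (u : p (sub A)) : star_of (s1 ++ bvec p u :: s2) t =
    dsum_in (@star_comp k p q I) (exist _ (Comp hs, Comp ht) h)
      (block_cat (pure s1 *t (u *t pure s2 : block_tens p (A :: map tag s2)))
         *t pure t).
  have hs' := hs; rewrite -(tag_insert _ _ u) in hs'.
  have h' : star_pred (Comp hs', Comp ht).
    by apply/andP; rewrite /= tag_insert.
  rewrite (star_ofE h').
  apply: (star_in_tagged (FG := exist _ (Comp hs', Comp ht) h')
    (FG' := exist _ (Comp hs, Comp ht) h)) => //=.
  by rewrite -(block_cat_pure s1 (bvec p u :: s2)).
by rewrite !E linearPl linearPr linearP linearPl linearP.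
Qed.

Lemma star_of_multilinear_r I s : multilinear (@star_of I s).
Proof.
move=> t1 A t2 a v w.
case: (boolP (star_ok (map tag s) (map tag t1 ++ A :: map tag t2))) => st; last first.
  by rewrite !star_of0 ?tag_insert // scaler0 addr0.
case/and4P: (st) => hs ht I0 FG.
have h : star_pred (Comp hs, Comp ht) by apply/andP.
have E (u : q (sub A)) : star_of s (t1 ++ bvec q u :: t2) =
    dsum_in (@star_comp k p q I) (exist _ (Comp hs, Comp ht) h)
      (pure s *t
       block_cat (pure t1 *t (u *t pure t2 : block_tens q (A :: map tag t2)))).
  have ht' := ht; rewrite -(tag_insert _ _ u) in ht'.
  have h' : star_pred (Comp hs, Comp ht').
    by apply/andP; rewrite /= tag_insert.
  rewrite (star_ofE h').
  apply: (star_in_tagged (FG := exist _ (Comp hs, Comp ht') h')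
    (FG' := exist _ (Comp hs, Comp ht) h)) => //=.
  by rewrite -(block_cat_pure t1 (bvec q u :: t2)).
by rewrite !E linearPl linearPr linearP linearPr linearP.
Qed.

Lemma star_ok_im (I J : finType) (f : bij I J) F G :
  star_ok F G -> star_ok (seq_im f F) (seq_im f G).
Proof.
case/and4P=> hF hG I0 FG.
have h : star_pred (Comp hF, Comp hG) by apply/andP.
have /andP[J0 FG'] := star_pred_im f (exist _ (Comp hF, Comp hG) h).
apply/and4P; split=> //; first exact: (is_comp_im f (Comp hF)).
exact: (is_comp_im f (Comp hG)).
Qed.

Lemma seq_imK (I J : finType) (f : I -> J) (g : J -> I) :
  cancel f g -> cancel (seq_im f) (seq_im g).
Proof.
move=> fK F; rewrite /seq_im -map_comp -[RHS]map_id; apply: eq_map => A /=.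
by rewrite -imset_comp (eq_imset _ fK) imset_id.
Qed.

Lemma star_of_map (I J : finType) (f : bij I J) s t :
  star_map p q f (star_of s t) =
  star_of (map (vec_map (inj_of_bij f)) s) (map (vec_map (inj_of_bij f)) t).
Proof.
have [g fK gK] := bijP f.
case: (boolP (star_ok (map tag s) (map tag t))) => st.
  have [[hs ht] h] := star_okP st.
  rewrite (star_ofE h) (star_map_pure _ (star_pred_vec_map f h)).
  exact/esym/star_ofE.
rewrite !star_of0 ?linear0 //; apply: contra st; rewrite !tag_vec_map.
move/(star_ok_im (Bij (Bijective gK fK))).
by rewrite /= !(seq_imK fK).
Qed.
End StarOf.

(** * Restriction of a pure tensor to a block *)

Section Part.
Variables (k : fieldType) (p : species k).

(** The factors of a pure tensor on the blocks contained in [B], as a tensor on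
[B]. *)
Definition block_part (I : finType) (B : {set I}) (s : seq (block_vec p I)) :
    seq (block_vec p (sub B)) :=
  map (vec_pull (sub_inj B)) [seq u : block_vec p I <- s | tag u \subset B].

Lemma block_part_cat I B (s t : seq (block_vec p I)) :
  block_part B (s ++ t) = block_part B s ++ block_part B t.
Proof. by rewrite /block_part filter_cat map_cat. Qed.

Lemma vec_pull_map (S J I : finType) (f : inj S I) (g : inj J I) (h : inj S J) u :
  (forall x, g (h x) = f x) -> vec_pull g (vec_map (p := p) f u) = vec_map h u.
Proof.
by move=> gh; rewrite -(vec_map_comp1 (f := h) (g := g) gh) vec_mapK.
Qed.

Lemma block_part_im (S I : finType) (f : inj S I) (B : {set S}) s :
  block_part (f @: B) (map (vec_map f) s) =
  map (vec_map (inj_of_bij (restr f B))) (block_part B s).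
Proof.
rewrite /block_part filter_map -!map_comp.
have -> : [seq u : block_vec p S <- s |
      preim (vec_map f) (fun u : block_vec p I => tag u \subset f @: B) u] =
    [seq u : block_vec p S <- s | tag u \subset B].
  apply: eq_filter => u /=; apply/subsetP/subsetP => [uB x xu|uB _ /imsetP[x xu ->]].
    by rewrite -(mem_imset _ _ (@injP _ _ f)); apply: uB; exact: imset_f.
  by apply: imset_f; exact: uB.
apply/eq_in_map => u; rewrite mem_filter => /andP[uB _] /=.
rewrite -{1}(vec_pullK (codom_sub_inj uB)).
rewrite (vec_map_comp1 (h := comp_inj f (sub_inj B))) //.
exact: vec_pull_map.
Qed.

Lemma block_part_full (S I : finType) (f : inj S I) (s : seq (block_vec p S)) :
  block_part (f @: setT) (map (vec_map f) s) =
  map (vec_map (inj_of_bij (img_bij f))) s.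
Proof.
rewrite /block_part filter_map -map_comp.
have -> : [seq u : block_vec p S <- s |
      preim (vec_map f) (fun u : block_vec p I => tag u \subset f @: setT) u] = s.
  by apply/all_filterP/allP => u _ /=; apply: imsetS; exact: subsetT.
by apply: eq_map => u /=; exact: vec_pull_map.
Qed.

Lemma block_part_disjoint (I : finType) (B : {set I}) (s : seq (block_vec p I)) :
  set0 \notin map tag s -> (forall A, A \in map tag s -> [disjoint A & B]) ->
  block_part B s = [::].
Proof.
move=> s0 sB; rewrite /block_part; apply/eqP; rewrite -size_eq0 size_map size_filter.
rewrite -leqn0 leqNgt -has_count -(has_map tag (fun A : {set I} => A \subset B)).
apply: contra s0 => /hasP[A As AB].
by have := sB _ As; rewrite -setI_eq0 (setIidPl AB) => /eqP <-.
Qed.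
End Part.

(** * The inverse of the comparison map *)

(** In the order of refinement [H <= F] for compositions. It holds whenever [H] is
the meet of [F] with another composition; carrying it along in [coarse_meet] is
simpler than deriving it from flags. *)
Definition coarsens (I : finType) (H F : seq {set I}) : bool :=
  all (fun A : {set I} => has (fun B : {set I} => A \subset B) H) F.

Definition coarse_meet (I : finType) (F G H : seq {set I}) : bool :=
  [&& is_comp F, is_comp G, is_comp H, is_meet F G H, coarsens H F & coarsens H G].

Lemma coarse_meet_unique (I : finType) (F G H H' : seq {set I}) :
  coarse_meet F G H -> coarse_meet F G H' -> H = H'.
Proof.
move=> /and5P[_ _ /and3P[H0 Hd _] /eqP FG _] /and5P[_ _ /and3P[H0' Hd' _] /eqP FG' _].
by apply: flag_inj; rewrite // FG FG'.
Qed.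

Section Inverse.
Variables (k : fieldType) (p q : species k).
Local Notation phi := (comparison p q).

(** The component on [B] of the inverse image of a pair of pure tensors, when [B]
is a block of the meet of their compositions. *)
Definition segment (I : finType) (s : seq (block_vec p I))
    (t : seq (block_vec q I)) (B : {set I}) : block_vec (star p q) I :=
  bvec (star p q) (star_of (block_part B s) (block_part B t) : star p q (sub B)).

Definition inv_pure (I : finType) (s : seq (block_vec p I))
    (t : seq (block_vec q I)) : free_obj (star p q) I :=
  if [pick H : comp I | coarse_meet (map tag s) (map tag t) H] is Some H
  then free_of (map (segment s t) H) else 0.

Lemma inv_pure_eq I s t (r : seq (block_vec (star p q) I)) hr :
  coarse_meet (map tag s) (map tag t) (map tag r) ->
  map (segment s t) (map tag r) = r -> inv_pure s t = @free_pure k (star p q) I r hr.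
Proof.
move=> ok rE; rewrite /inv_pure; case: pickP => [H okH|/(_ (Comp hr))].
  by rewrite (coarse_meet_unique okH ok) rE; exact: free_ofE.
by rewrite /= ok.
Qed.

Lemma block_part_insert_out (r : species k) (I : finType) (B A : {set I})
    (s1 s2 : seq (block_vec r I)) (v : r (sub A)) :
  ~~ (A \subset B) -> block_part B (s1 ++ bvec r v :: s2) = block_part B (s1 ++ s2).
Proof. by move=> AB; rewrite !block_part_cat /block_part /= (negPf AB). Qed.

Lemma block_part_insert_in (r : species k) (I : finType) (B A : {set I})
    (s1 s2 : seq (block_vec r I)) (v : r (sub A)) :
  A \subset B -> block_part B (s1 ++ bvec r v :: s2) =
  block_part B s1 ++ bvec r (pull_lin r (sub_inj B) A v) :: block_part B s2.
Proof. by move=> AB; rewrite block_part_cat /block_part /= AB. Qed.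

(** Multilinearity of [inv_pure] rests on this: a factor of a pure tensor enters
exactly one segment. *)
Lemma coarsens_block (I : finType) (H F : seq {set I}) A :
  is_comp F -> is_comp H -> coarsens H F -> A \in F ->
  exists H1 B H2, [/\ H = H1 ++ B :: H2, A \subset B &
    forall C, C \in H1 ++ H2 -> ~~ (A \subset C)].
Proof.
move=> /and3P[F0 _ _] /and3P[_ Hd _] /allP HF AF.
have /hasP[B BH AB] := HF _ AF; case/splitPr: BH Hd => H1 H2 Hd.
exists H1, B, H2; split=> // C CH.
have BC : [disjoint B & C].
  move: Hd; rewrite pairwise_cat /= => /and4P[/allrelP H12 _ /allP BH2 _].
  move: CH; rewrite mem_cat => /orP[CH|/BH2 //].
  by rewrite disjoint_sym; apply: H12; rewrite ?mem_head.
apply: contra F0 => AC; suff -> : set0 = A by [].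
apply/esym/eqP; rewrite -subset0 -(disjoint_setI0 BC).
by rewrite subsetI AB.
Qed.

Lemma inv_pure_multilinear_l I t : multilinear (fun s => @inv_pure I s t).
Proof.
move=> s1 A s2 a v w; rewrite /inv_pure !tag_insert.
case: pickP => [H /and5P[hF _ hH _ /andP[HF _]]|_]; last first.
  by rewrite scaler0 addr0.
have AF : A \in map tag s1 ++ A :: map tag s2 by rewrite mem_cat mem_head orbT.
have [H1 [B [H2 [-> AB AH]]]] := coarsens_block hF hH HF AF.
have E (u : p (sub A)) : map (segment (s1 ++ bvec p u :: s2) t) (H1 ++ B :: H2) =
    map (segment (s1 ++ s2) t) H1 ++
    bvec (star p q) (star_of (block_part B s1 ++ bvec p (pull_lin p (sub_inj B) A u) ::
      block_part B s2) (block_part B t) : star p q (sub B)) ::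
    map (segment (s1 ++ s2) t) H2.
  rewrite map_cat /=; congr (_ ++ _ :: _).
  - apply/eq_in_map => C CH; rewrite /segment block_part_insert_out //.
    by apply: AH; rewrite mem_cat CH.
  - by rewrite /segment block_part_insert_in.
  apply/eq_in_map => C CH; rewrite /segment block_part_insert_out //.
  by apply: AH; rewrite mem_cat CH orbT.
by rewrite !E linearP star_of_multilinear_l free_of_multilinear.
Qed.

Lemma inv_pure_multilinear_r I s : multilinear (@inv_pure I s).
Proof.
move=> t1 A t2 a v w; rewrite /inv_pure !tag_insert.
case: pickP => [H /and5P[_ hG hH _ /andP[_ HG]]|_]; last first.
  by rewrite scaler0 addr0.
have AG : A \in map tag t1 ++ A :: map tag t2 by rewrite mem_cat mem_head orbT.
have [H1 [B [H2 [-> AB AH]]]] := coarsens_block hG hH HG AG.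
have E (u : q (sub A)) : map (segment s (t1 ++ bvec q u :: t2)) (H1 ++ B :: H2) =
    map (segment s (t1 ++ t2)) H1 ++
    bvec (star p q) (star_of (block_part B s) (block_part B t1 ++
      bvec q (pull_lin q (sub_inj B) A u) :: block_part B t2) : star p q (sub B)) ::
    map (segment s (t1 ++ t2)) H2.
  rewrite map_cat /=; congr (_ ++ _ :: _).
  - apply/eq_in_map => C CH; rewrite /segment block_part_insert_out //.
    by apply: AH; rewrite mem_cat CH.
  - by rewrite /segment block_part_insert_in.
  apply/eq_in_map => C CH; rewrite /segment block_part_insert_out //.
  by apply: AH; rewrite mem_cat CH orbT.
by rewrite !E linearP star_of_multilinear_r free_of_multilinear.
Qed.

(** The elements on which [inv_pure] visibly undoes the comparison. They are
described in a form that passes to products, which the bare equation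
between [x] and the inverse of its image would not. *)
Definition recoverable (I : finType) (x : free_obj (star p q) I) :=
  exists s hs t ht r hr,
    [/\ x = @free_pure k (star p q) I r hr,
        phi I x = @free_pure k p I s hs *t @free_pure k q I t ht,
        coarse_meet (map tag s) (map tag t) (map tag r)
      & map (segment s t) (map tag r) = r].

Lemma recoverable_nil I h : recoverable (@free_pure k (star p q) I [::] h).
Proof.
exists [::], h, [::], h, [::], h; split=> //; last first.
  by apply/and5P; split=> //; rewrite /is_meet ?setIid // h.
exact: comparison_nil.
Qed.

Lemma coarsens_im (I J : finType) (f : I -> J) (H F : seq {set I}) :
  coarsens H F -> coarsens (seq_im f H) (seq_im f F).
Proof.
move=> /allP HF; apply/allP=> _ /mapP[A /HF/hasP[B BH AB] ->].
by apply/hasP; exists (f @: B); [exact: map_f|exact: imsetS].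
Qed.

(** On the block [S] of the new meet the two tensors restrict to [s1] and [t1];
on the other blocks they restrict to what they were on [T]. *)
Lemma recoverable_step S T I (d : decomp S T I) s1 t1 hs1 ht1 h1 y : (0 < #|S|)%N ->
  recoverable y ->
  recoverable (free_mu (star p q) d
    (gen (star p q) S (@star_pure k p q S s1 t1 hs1 ht1 h1) *t y)).
Proof.
move=> S0 [s2 [hs2 [t2 [ht2 [r2 [hr2 [-> yE ok rE]]]]]]].
have hs := is_comp_vec_cat d hs1 hs2; have ht := is_comp_vec_cat d ht1 ht2.
set z := star_pure h1.
pose r := bvec (star p q) (sp_map (star p q) (img_bij (incl d)) z) ::
  map (vec_map (incr d)) r2.
have hr : is_comp (map tag r).
  have hz : is_comp (map tag [:: bvec (star p q) (sp_map (star p q) (full_bij S) z)]).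
    by rewrite /= is_comp_full.
  by have := is_comp_vec_cat d hz hr2.
have tag_r : map tag r = (incl d @: setT) :: seq_im (incr d) (map tag r2).
  by rewrite /r /=; congr (_ :: _); exact: tag_vec_map.
case/and5P: (ok) => _ _ _ M2 /andP[C2s C2t].
case/andP: (h1) => _ /= M1.
have incrU (F : seq {set T}) A : A \in seq_im (incr d) F -> A \subset ~: (incl d @: setT).
  case/mapP=> B _ ->; apply/subsetP=> _ /imsetP[x _ ->]; rewrite inE.
  by apply/imsetP=> -[y0 _ /decomp_incr_neq_incl].
have coarsens_cat (F : seq {set S}) (G : seq {set T}) :
    coarsens (map tag r2) G ->
    coarsens (map tag r) (seq_im (incl d) F ++ seq_im (incr d) G).
  move=> C2; rewrite tag_r /coarsens all_cat; apply/andP; split.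
    by apply/allP=> _ /mapP[A _ ->] /=; rewrite imsetS ?subsetT.
  apply: sub_all (coarsens_im (incr d) C2) => A /= ->; exact: orbT.
exists _, hs, _, ht, r, hr; split.
- by rewrite mu_gen_pure // (free_ofE hr).
- rewrite -[free_mu (star p q) d]/(mu (free_monoid (star p q)) d) (mon_hom_mu phi).
  rewrite tens_mapE comparison_gen_pure yE.
  rewrite [LHS](@had_muE k (free_monoid p) (free_monoid q)).
  by congr (_ *t _); exact: free_mu_pure.
- apply/and5P; split=> //.
    rewrite tag_r !map_cat !tag_vec_map; apply: is_meet_cat.
    + by rewrite bigcup_seq_im (comp_cover hs1).
    + by rewrite bigcup_seq_im (comp_cover ht1).
    + exact: incrU.
    + exact: incrU.
    + exact: (is_meet_im (incl d) M1).
    + exact: is_meet_im.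
  by rewrite !map_cat !tag_vec_map !coarsens_cat.
(* On the first block, the parts of both tensors are those of the generator. *)
have partU (w : species k) (u : seq (block_vec w S)) (v : seq (block_vec w T)) :
    is_comp (map tag v) ->
    block_part (incl d @: setT) (map (vec_map (incl d)) u ++ map (vec_map (incr d)) v) =
    map (vec_map (inj_of_bij (img_bij (incl d)))) u.
  move=> hv; rewrite block_part_cat block_part_full block_part_disjoint ?cats0 //.
    by rewrite tag_vec_map set0_seq_im; exact: comp_blocks_neq0.
  by move=> A; rewrite tag_vec_map => /incrU; rewrite disjoints_subset.
(* On a later block, the generator contributes nothing. *)
have partB (w : species k) (u : seq (block_vec w S)) (v : seq (block_vec w T))
    (B : {set T}) : is_comp (map tag u) ->
    block_part (incr d @: B) (map (vec_map (incl d)) u ++ map (vec_map (incr d)) v) =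
    map (vec_map (inj_of_bij (restr (incr d) B))) (block_part B v).
  move=> hu; rewrite block_part_cat block_part_im block_part_disjoint //.
    by rewrite tag_vec_map set0_seq_im; exact: comp_blocks_neq0.
  move=> A; rewrite tag_vec_map => /mapP[C _ ->]; rewrite -setI_eq0; apply/eqP/setP=> x.
  rewrite !inE; apply/negP=> /andP[/imsetP[a _ ->] /imsetP[b _ /esym]].
  exact: decomp_incr_neq_incl.
rewrite tag_r /r /=; congr (_ :: _).
  rewrite /segment !partU // -star_of_map.
  by congr (bvec (star p q) (sp_map (star p q) _ _)); exact: star_ofE.
rewrite -{2}rE /seq_im -!map_comp; apply: eq_map => u /=.
by rewrite /segment !partB // -star_of_map.
Qed.

Lemma star_ind (I : finType) (P : star_obj p q I -> Prop) :
  P 0 -> (forall a x y, P x -> P y -> P (a *: x + y)) ->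
  (forall s t hs ht h, P (@star_pure k p q I s t hs ht h)) -> forall x, P x.
Proof.
move=> P0 PD Ppure x; rewrite [x]dsum_sumE.
apply: big_ind => // [y z Py Pz|[[F G] h] _].
  by rewrite -[y]scale1r; apply: (PD).
elim/tens_ind: (x _) => [|v w y Py]; first by rewrite linear0.
rewrite linearD -[dsum_in _ _ (_ *t _)]scale1r; apply: (PD) => // {Py y}.
elim/block_ind: v => [|a v v' IHv IHv'|s e].
- by rewrite linear0l linear0.
- by rewrite linearPl linearP; apply: (PD).
elim/block_ind: w => [|a w w' IHw IHw'|t e'].
- by rewrite linear0r linear0.
- by rewrite linearPr linearP; apply: (PD).
case: F G h e e' => [F hF] [G hG] h /= e e'; subst F; subst G.
exact: Ppure.
Qed.

Lemma recoverable_span I (x : free_obj (star p q) I) (Q : free_obj (star p q) I -> Prop) :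
  Q 0 -> (forall a x y, Q x -> Q y -> Q (a *: x + y)) ->
  (forall x, recoverable x -> Q x) -> Q x.
Proof.
(* Quantifying over the linear closure property keeps the induction hypothesis
   usable inside a product with a fixed generator. *)
pose P I (x : free_obj (star p q) I) := forall Q : free_obj (star p q) I -> Prop,
  Q 0 -> (forall a x y, Q x -> Q y -> Q (a *: x + y)) ->
  (forall x, recoverable x -> Q x) -> Q x.
move: I x Q; apply: (@free_gen_ind k (star p q) P)
  => [I|I a x y Px Py|I h|S T I d v y S0 Py] Q Q0 QD Qr //.
- by apply: (QD); [apply: Px|apply: Py].
- by apply: Qr; exact: recoverable_nil.
apply: (Py (fun y => Q (free_mu _ d (gen _ S v *t y))))
  => [|a u w Qu Qw|{Py}y ry].
- by rewrite linear0r linear0.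
- by rewrite linearPr linearP; exact: (QD).
elim/star_ind: v => [|a u w Qu Qw|s t hs ht h].
- by rewrite linear0 linear0l linear0.
- by rewrite linearP linearPl linearP; exact: (QD).
by apply: Qr; exact: recoverable_step.
Qed.

Lemma comparison_inj I : injective (phi I).
Proof.
have [psi psiE] := free_lift2 (@inv_pure_multilinear_l I) (@inv_pure_multilinear_r I).
apply: (can_inj (g := psi)) => x.
apply: (@recoverable_span I x (fun x => psi (phi I x) = x)).
- by rewrite !linear0.
- by move=> a y z IHy IHz; rewrite !linearP IHy IHz.
move=> _ [s [hs [t [ht [r [hr [-> -> ok rE]]]]]]].
by rewrite psiE; exact: inv_pure_eq.
Qed.
End Inverse.

(** * Bijective morphisms of monoids *)

Lemma mon_iso_bijective (k : fieldType) (M N : monoid k) (f : mon_hom M N) :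
  (forall I, injective (f I)) -> (forall I y, exists x, f I x = y) -> mon_iso f.
Proof.
move=> fi fs; pose g I y := projT1 (cid (fs I y)).
have gK I y : f I (g I y) = y := projT2 (cid (fs I y)).
have glin I : linear (g I).
  by move=> a x y; apply: (fi I); rewrite linearP !gK.
pose G I := pack_linear (@glin I).
have GE I y : G I y = g I y by exact: pack_linearE.
have fG I y : f I (G I y) = y by rewrite GE.
have Gnat I J (h : bij I J) y : G J (sp_map N h y) = sp_map M h (G I y).
  by apply: (fi J); rewrite fG sp_hom_nat fG.
pose Gsp := @SpHom k N M G Gnat.
have Gmu S T I (d : decomp S T I) z :
    Gsp I (mu N d z) = mu M d (tens_map (Gsp S) (Gsp T) z).
  apply: (tens_ext (f := Gsp I \o mu N d) (g := mu M d \o tens_map (Gsp S) (Gsp T))) z.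
  move=> x y; apply: (fi I); rewrite [LHS]fG /= tens_mapE mon_hom_mu tens_mapE.
  by rewrite !fG.
have Gunit c : Gsp fin0 (mon_unit N c) = mon_unit M c.
  by apply: (fi fin0); rewrite [LHS]fG mon_hom_unit.
exists (MonHom Gmu Gunit); split=> [I x|I y]; last exact: fG.
by apply: (fi I); exact: fG.
Qed.

Theorem theorem3p8 (k : fieldType) :
  exists phi : forall p q : pos_species k,
      mon_hom (free_monoid (star p q))
              (hadamard (free_monoid p) (free_monoid q)),
    (forall p q : pos_species k, mon_iso (phi p q)) /\
    (forall (p p' q q' : pos_species k) (a : sp_hom p p') (b : sp_hom q q')
        (I : finType) (x : free_monoid (star p q) I),
      phi p' q' I (free_hom (star_hom a b) I x) =
      had_hom (free_hom a) (free_hom b) I (phi p q I x)).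
Proof.
exists (fun p q => comparison p q); split=> [p q|p p' q q' a b I x].
  by apply: mon_iso_bijective; [exact: comparison_inj|exact: comparison_surj].
exact: comparison_natural.
Qed.
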